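(* Let $\mathcal{D}\subset\mathbb{R}^N$ be open and bounded and let $\epsilon>0$. For any bounded Borel $F:\mathbb{R}^N\to\mathbb{R}$, the problem $$u(x)=\begin{cases}\mathcal{A}_\epsilon u(x)&\text{for }x\in\mathcal{D}\\ F(x)&\text{for }x\in\mathbb{R}^N\setminus\mathcal{D}\end{cases}$$ has a unique bounded Borel solution $u=u_\epsilon^F:\mathbb{R}^N\to\mathbb{R}$, and $\|u_\epsilon^F\|_{L^\infty}\le\|F\|_{L^\infty}$. Moreover, the solution operator is monotone: if $F,\bar F:\mathbb{R}^N\to\mathbb{R}$ are bounded Borel and $F\le\bar F$, then $u_\epsilon^F\le u_\epsilon^{\bar F}$.
   Context: Fix an integer $N\ge 2$, $\mathbf p\in[2,\infty)$ and $s\in(\frac12,1)$. $e_1,e_2,\dots$ is the standard basis of $\mathbb{R}^N$, $\angle(y,z)$ the angle between vectors. $\mathrm{d}\mu_s^N(z)=\frac{C(N,s)}{|z|^{N+2s}}\,\mathrm{d}z$ with $C(N,s)=\frac{4^s s\,\Gamma(\frac N2+s)}{\pi^{N/2}\Gamma(1-s)}$. Let $\alpha_{\mathbf p}\in(0,\frac\pi2]$ be the angle such that, with $A_{\mathbf p}=\{|z|=1:\ \angle(e_1,z)<\alpha_{\mathbf p}\}$ and $\sigma$ the surface measure on the unit sphere, $\mathbf p-1=\int_{A_{\mathbf p}}\langle z,e_1\rangle^2\,\mathrm{d}\sigma(z)\big/\int_{A_{\mathbf p}}\langle z,e_2\rangle^2\,\mathrm{d}\sigma(z)$. For $0\le a\le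 b\le\infty$ and $|y|=1$ let $T_{\mathbf p}^{a,b}(y)=\{z\in\mathbb{R}^N:\ \angle(y,z)<\alpha_{\mathbf p},\ a<|z|<b\}$. For bounded Borel $u$ and $\epsilon>0$ define $$\mathcal{A}_\epsilon u(x)=\frac12\Big(\sup_{|y|=1}⨍_{T_{\mathbf p}^{\epsilon,\infty}(y)}u(x+z)\,\mathrm{d}\mu_s^N(z)+\inf_{|y|=1}⨍_{T_{\mathbf p}^{\epsilon,\infty}(y)}u(x+z)\,\mathrm{d}\mu_s^N(z)\Big),$$ where $⨍_T f\,\mathrm{d}\mu_s^N=\frac{1}{\mu_s^N(T)}\int_T f\,\mathrm{d}\mu_s^N$. $\|\cdot\|_{L^\infty}$ is the supremum norm on $\mathbb{R}^N$. *)

(* Defs.v *)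
From HB Require Import structures.
From mathcomp Require Import all_boot all_order all_algebra.
From mathcomp Require Import all_classical all_reals all_analysis.
From mathcomp Require Import measurable_realfun.

Set Implicit Arguments.
Unset Strict Implicit.
Unset Printing Implicit Defensive.
Import Order.TTheory GRing.Theory Num.Theory.
Import numFieldNormedType.Exports.

Local Open Scope classical_set_scope.
Local Open Scope ring_scope.

Section borel_matrix.
Context (R : realType) (m n : nat).

Definition borel_mx : set (set 'M[R]_(m, n)) := <<s @open 'M[R]_(m, n) >>.

Let borel_mx0 : borel_mx set0. Proof. exact: sigma_algebra0. Qed.
Let borel_mxC A : borel_mx A -> borel_mx (~` A).
Proof. exact: sigma_algebraC. Qed.
Let borel_mx_bigcup (F : (set 'M[R]_(m, n))^nat) :
  (forall i, borel_mx (F i)) -> borel_mx (\bigcup_i F i).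
Proof. exact: sigma_algebra_bigcup. Qed.

HB.instance Definition _ := @isMeasurable.Build
  (sigma_display (@open 'M[R]_(m, n))) 'M[R]_(m, n)
  borel_mx borel_mx0 borel_mxC borel_mx_bigcup.
End borel_matrix.

Section borel_rV.
Context (R : realType).

Lemma open_measurable_rV n (A : set 'rV[R]_n) : open A -> measurable A.
Proof. by move=> oA; exact: sub_sigma_algebra. Qed.

Lemma continuous_measurable_rV n (f : 'rV[R]_n -> R) :
  continuous f -> measurable_fun setT f.
Proof.
move=> /continuousP cf; apply: (measurability _ (RGenOpens.measurableE R)).
move=> _ [_ [a [b ->] <-]]; rewrite setTI.
by apply: open_measurable_rV; apply: cf; exact: interval_open.
Qed.

Lemma measurable_coord n (i : 'I_n) :
  measurable_fun setT (fun v : 'rV[R]_n => v ord0 i).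
Proof. by apply: continuous_measurable_rV; exact: coord_continuous. Qed.

(* every open subset of R^n is a countable union of rational boxes *)
Lemma measurable_fun_rV d (T : measurableType d) n (f : T -> 'rV[R]_n) :
  (forall i, measurable_fun setT (fun t => f t ord0 i)) -> measurable_fun setT f.
Proof.
move=> mf; apply: (measurability (@open 'rV[R]_n)) => //.
move=> _ [U oU <-]; rewrite setTI.
pose c (q : 'rV[rat]_n) : 'rV[R]_n := map_mx ratr q.
pose P := [set qk : 'rV[rat]_n * nat |
  forall v : 'rV[R]_n, (forall i, `|v ord0 i - c qk.1 ord0 i| < qk.2.+1%:R^-1) -> U v].
have -> : f @^-1` U = \bigcup_(qk in P)
    \bigcap_(i in [set: 'I_n]) [set t | `|f t ord0 i - c qk.1 ord0 i| < qk.2.+1%:R^-1].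
  apply/seteqP; split => [t /= Uft|t [[q k] /= Pqk ft]]; last first.
    by apply: Pqk => i; exact: ft.
  have /nbhs_ballP [e /= e0 eU] : nbhs (f t) U by exact: open_nbhs_nbhs.
  pose k := Num.bound (2 / e).
  have k0 : (0 : R) < k.+1%:R^-1 by rewrite invr_gt0.
  have ke : k.+1%:R^-1 + k.+1%:R^-1 < e.
    rewrite -mulr2n -(mulr_natl _ 2) ltr_pdivrMr// mulrC -ltr_pdivrMr//.
    apply: (@lt_trans _ _ k%:R); last by rewrite ltr_nat.
    by rewrite /k; apply: archi_boundP; rewrite divr_ge0// ltW.
  have /choice[q hq] : forall i, exists q : rat, `|f t ord0 i - ratr q| < k.+1%:R^-1.
    move=> i.
    have [q /itvP qi] := @rat_in_itvoo R (f t ord0 i - k.+1%:R^-1)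
      (f t ord0 i + k.+1%:R^-1) ltac:(by rewrite ltrBlDr -addrA ltrDl addr_gt0).
    by exists q; rewrite distrC ltr_distl !qi.
  exists (\row_i q i, k) => /=.
    move=> v hv; apply: eU; split => // a b; rewrite (ord1 a) /ball/=; apply: (lt_trans _ ke).
    rewrite -(subrKA (ratr (q b))) (le_lt_trans (ler_normD _ _))// ltrD//.
    by rewrite distrC; have := hv b; rewrite /c !mxE.
  by move=> i _ /=; rewrite /c !mxE.
rewrite bigcup_mkcond; apply: countable_bigcupT_measurable => [|[q k]].
  exact: countableP.
case: ifP => // _.
apply: fin_bigcap_measurable => // i _.
have : measurable_fun setT (fun t => `|f t ord0 i - c q ord0 i|).
  by apply: measurableT_comp => //; apply: measurable_funB.
by move=> /(_ measurableT `]-oo, k.+1%:R^-1[%classic (measurable_itv _));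
  rewrite setTI; congr measurable; apply/seteqP; split => t /=; rewrite in_itv.
Qed.

Definition cons_rV n (xv : R * 'rV[R]_n) : 'rV[R]_n.+1 :=
  row_mx (const_mx xv.1 : 'rV[R]_1) xv.2.

Lemma measurable_cons_rV n : measurable_fun setT (@cons_rV n).
Proof.
apply: measurable_fun_rV => i.
case: (split_ordP (i : 'I_(1 + n))) => j ->.
  rewrite (_ : (fun _ => _) = fst)//.
  apply/funext => -[x v] /=.
  exact: etrans (row_mxEl (const_mx x : 'rV[R]_1) v ord0 j) (mxE _ _ _ _).
rewrite (_ : (fun _ => _) = (fun v : 'rV[R]_n => v ord0 j) \o snd).
  by apply: measurableT_comp => //; exact: measurable_coord.
apply/funext => -[x v] /=; exact: (row_mxEr (const_mx x : 'rV[R]_1) v).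
Qed.

Definition uncons_rV n (v : 'rV[R]_n.+1) : R * 'rV[R]_n :=
  (v ord0 ord0, rsubmx (v : 'rV_(1 + n))).

Lemma cons_rVK n : cancel (@cons_rV n) (@uncons_rV n).
Proof.
move=> [x v]; rewrite /uncons_rV /cons_rV row_mxKr; congr pair.
transitivity (row_mx (const_mx x : 'rV[R]_1) v ord0 (lshift n ord0)).
  by congr (row_mx _ _ _ _); exact/val_inj.
by rewrite row_mxEl mxE.
Qed.

Lemma measurable_uncons_rV n : measurable_fun setT (@uncons_rV n).
Proof.
apply: measurable_fun_pair; first exact: measurable_coord.
apply: measurable_fun_rV => i; under eq_fun do rewrite mxE.
exact: measurable_coord.
Qed.

End borel_rV.

Section lebesgue_measure_rV.
Context (R : realType).
Local Open Scope ereal_scope.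

(* iterated product of the Lebesgue measure of the real line *)
Fixpoint lebesgue_rV (n : nat) : set 'rV[R]_n -> \bar R :=
  match n with
  | 0 => \d_(0%R : 'rV[R]_0)
  | n'.+1 => pushforward (@lebesgue_measure R \x @lebesgue_rV n') (@cons_rV R n')
  end.

Lemma lebesgue_rV_subproof n :
  {m : {sigma_finite_measure set 'rV[R]_n -> \bar R} |
    m = @lebesgue_rV n :> (set 'rV[R]_n -> \bar R)}.
Proof.
elim: n => [|n [m IH]].
  by exists (\d_(0%R : 'rV[R]_0) : {sigma_finite_measure set _ -> \bar R}).
pose P : {measure set (measurableTypeR R * 'rV[R]_n)%type -> \bar R} :=
  @lebesgue_measure R \x m.
have mc := @measurable_cons_rV R n.
pose Q : {measure set _ -> \bar R} :=
  measure_function_pushforward__canonical__measure_function_Measure P mc.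
have Qfin : sigma_finite setT (Q : set _ -> \bar R).
  have /sigma_finiteP[F [FT ndF mF]] := sigma_finiteT (@lebesgue_measure R).
  have /sigma_finiteP[G [GT ndG mG]] := sigma_finiteT m.
  exists (fun k => @uncons_rV R n @^-1` (F k `*` G k)).
    apply/seteqP; split => // v _ /=.
    have : [set: R] (uncons_rV v).1 by []. rewrite FT => -[i _ Fi].
    have : [set: 'rV[R]_n] (uncons_rV v).2 by []. rewrite GT => -[j _ Gj].
    exists (maxn i j) => //; split.
    - by move: Fi; exact/subsetPset/ndF/leq_maxl.
    - by move: Gj; exact/subsetPset/ndG/leq_maxr.
  move=> k; have [? ?] := mF k; have [? ?] := mG k; split.
    by rewrite -[X in measurable X]setTI; apply: measurable_uncons_rV => //; exact: measurableX.
  rewrite /= /pushforward -comp_preimage /= (_ : _ \o _ = id); last first.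
    by apply/funext => x; exact: cons_rVK.
  by rewrite /P/= product_measure1E// lte_mul_pinfty// ge0_fin_numE.
pose Q1 := Measure_isSigmaFinite.Build _ _ _ Q Qfin.
pose Q2 : {sigma_finite_measure set _ -> \bar R} := HB.pack (Measure.sort Q) (Measure.class Q) Q1.
by exists Q2; rewrite /= /P IH.
Qed.

Let leb0 n : @lebesgue_rV n set0 = 0.
Proof. by case: (lebesgue_rV_subproof n) => m <-. Qed.
Let leb_ge0 n A : 0 <= @lebesgue_rV n A.
Proof. by case: (lebesgue_rV_subproof n) => m <-. Qed.
Let leb_sigma_additive n : semi_sigma_additive (@lebesgue_rV n).
Proof.
by case: (lebesgue_rV_subproof n) => m <-; exact: measure_semi_sigma_additive.
Qed.
Let leb_sigma_finite n : sigma_finite setT (@lebesgue_rV n).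
Proof. by case: (lebesgue_rV_subproof n) => m <-; exact: sigma_finiteT. Qed.

HB.instance Definition _ n := isMeasure.Build _ _ _ (@lebesgue_rV n)
  (leb0 n) (@leb_ge0 n) (@leb_sigma_additive n).
HB.instance Definition _ n := Measure_isSigmaFinite.Build _ _ _ (@lebesgue_rV n)
  (@leb_sigma_finite n).

End lebesgue_measure_rV.

Section euclidean.
Context (R : realType) (N : nat).
Implicit Types y z : 'rV[R]_N.

Definition dotp y z : R := \sum_(i < N) y ord0 i * z ord0 i.

(* the library norm `|z| on 'rV[R]_N is the sup norm; it induces the same
   topology and the same bounded sets as enorm *)
Definition enorm z : R := Num.sqrt (dotp z z).

Definition sphere : set 'rV[R]_N := [set z | enorm z = 1].

Definition angle y z : R := acos (dotp y z / (enorm y * enorm z)).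

(* standard basis vectors e_1, ..., e_N; the index k is 1-based *)
Definition std_basis (k : nat) : 'rV[R]_N := \row_(i < N) (i.+1 == k)%:R.

Lemma measurable_dotp y : measurable_fun setT (dotp y).
Proof.
apply: measurable_sum => i; apply: measurable_funM => //.
exact: measurable_coord.
Qed.

Lemma measurable_enorm : measurable_fun setT enorm.
Proof.
apply: (@measurableT_comp _ _ _ _ _ _ (@Num.sqrt R)).
  by apply: continuous_measurable_fun; exact: sqrt_continuous.
by apply: measurable_sum => i; apply: measurable_funM; exact: measurable_coord.
Qed.

Definition direction z : 'rV[R]_N := (enorm z)^-1 *: z.

Lemma measurable_direction : measurable_fun setT direction.
Proof.
apply: measurable_fun_rV => i.
rewrite (_ : (fun _ => _) = (fun z => enorm z `^ (-1) * z ord0 i)); last first.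
  by apply/funext => z; rewrite mxE powR_inv1// sqrtr_ge0.
apply: measurable_funM; last exact: measurable_coord.
apply: (@measurableT_comp _ _ _ _ _ _ (@powR R ^~ (-1)) _ enorm) => //.
exact: measurable_enorm.
Qed.

Local Open Scope ereal_scope.

(* surface measure of the unit sphere, normalised by integration in polar
   coordinates: N times the volume of the cone {rz | z in A, 0 < r <= 1} *)
Definition surface_measure (A : set 'rV[R]_N) : \bar R :=
  N%:R%:E * lebesgue_rV [set z | (0 < enorm z <= 1)%R /\ A (direction z)].

Let ball0 : set 'rV[R]_N := [set z | (0 < enorm z <= 1)%R].

Let mball0 : measurable ball0.
Proof.
have := measurable_enorm measurableT (measurable_itv `]0%R, 1%R]).
by rewrite setTI; congr measurable; apply/seteqP; split => z /=; rewrite in_itv.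
Qed.

Let surface_measureE : surface_measure = mscale ((N%:R : R)%:nng)%R
  (measure_function_pushforward__canonical__measure_function_Measure
    (mrestr (@lebesgue_rV R N) mball0) measurable_direction).
Proof.
apply/funext => A; rewrite /mscale /= /pushforward /mrestr.
by congr (_ * lebesgue_rV _); apply/seteqP; split => z [].
Qed.

Let surface0 : surface_measure set0 = 0.
Proof. by rewrite surface_measureE measure0. Qed.
Let surface_ge0 A : 0 <= surface_measure A.
Proof. by rewrite surface_measureE measure_ge0. Qed.
Let surface_sigma_additive : semi_sigma_additive surface_measure.
Proof. by rewrite surface_measureE; exact: measure_semi_sigma_additive. Qed.

HB.instance Definition _ := isMeasure.Build _ _ _ surface_measure
  surface0 surface_ge0 surface_sigma_additive.

End euclidean.

Section levy.
Context (R : realType).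

Definition Gamma (t : R) : R :=
  \int[lebesgue_measure]_(x in `]0, +oo[) (x `^ (t - 1) * expR (- x)).

Definition levy_const (N : nat) (s : R) : R :=
  (4 `^ s * s * Gamma (N%:R / 2 + s)) / (pi `^ (N%:R / 2) * Gamma (1 - s)).

Definition levy_density (N : nat) (s : R) (z : 'rV[R]_N) : R :=
  levy_const N s / enorm z `^ (N%:R + 2 * s).

(* for 0 <= s this is a measure, see levy_measureP *)
Definition levy_measure (N : nat) (s : R) (A : set 'rV[R]_N) : \bar R :=
  (\int[@lebesgue_rV R N]_(z in A) (levy_density s z)%:E)%E.

Lemma Gamma_ge0 t : 0 <= Gamma t.
Proof.
by apply: Rintegral_ge0 => x _; rewrite mulr_ge0 ?powR_ge0 ?expR_ge0.
Qed.

Lemma levy_density_ge0 N s z : 0 <= s -> 0 <= @levy_density N s z.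
Proof.
by move=> s0; rewrite divr_ge0 ?powR_ge0// divr_ge0// ?mulr_ge0
  ?powR_ge0 ?Gamma_ge0.
Qed.

Lemma measurable_levy_density N s : measurable_fun setT (@levy_density N s).
Proof.
rewrite (_ : levy_density s =
    fun z => levy_const N s * enorm z `^ (- (N%:R + 2 * s))); last first.
  by apply/funext => z; rewrite powRN.
apply: measurable_funM => //.
apply: (@measurableT_comp _ _ _ _ _ _ (@powR R ^~ _) _ (@enorm R N)) => //.
exact: measurable_enorm.
Qed.

Lemma levy_measureP N s : 0 <= s -> exists m : {measure set 'rV[R]_N -> \bar R},
  m = @levy_measure N s :> (set 'rV[R]_N -> \bar R).
Proof.
move=> s0; set m := levy_measure s.
have m0 : (m set0 = 0)%E by exact: integral_set0.
have m_ge0 A : (0 <= m A)%E.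
  by apply: integral_ge0 => z _; rewrite lee_fin levy_density_ge0.
have m_sadd : semi_sigma_additive m.
  apply: semi_sigma_additive_nng_induced => [|z].
    by apply/measurable_EFinP; exact: measurable_levy_density.
  by rewrite lee_fin levy_density_ge0.
pose M := isMeasure.Build _ _ _ m m0 m_ge0 m_sadd.
by exists (HB.pack m M : {measure set 'rV[R]_N -> \bar R}).
Qed.

End levy.

Section operator.
Context (R : realType) (N : nat).
Implicit Types (u F : 'rV[R]_N -> R) (x y z : 'rV[R]_N).

Definition cap (alpha : R) : set 'rV[R]_N :=
  [set z | enorm z = 1 /\ angle (std_basis R N 1) z < alpha].

Definition is_alpha (p alpha : R) : Prop :=
  0 < alpha <= pi / 2 /\
  p - 1 =
    (\int[@surface_measure R N]_(z in cap alpha) (dotp z (std_basis R N 1)) ^+ 2)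
    / (\int[@surface_measure R N]_(z in cap alpha) (dotp z (std_basis R N 2)) ^+ 2).

Definition cone (alpha : R) (a b : \bar R) y : set 'rV[R]_N :=
  [set z | angle y z < alpha /\ (a < (enorm z)%:E < b)%E].

Definition average (s : R) (T : set 'rV[R]_N) (f : 'rV[R]_N -> R) : R :=
  fine (\int[@levy_measure R N s]_(z in T) (f z)%:E)%E
  / fine (levy_measure s T).

Definition A_op (alpha s eps : R) u x : R :=
  2^-1 *
  (sup [set average s (cone alpha eps%:E +oo%E y) (fun z => u (x + z))
       | y in @sphere R N]
   + inf [set average s (cone alpha eps%:E +oo%E y) (fun z => u (x + z))
       | y in @sphere R N]).

Definition bounded_borel u : Prop := measurable_fun setT u /\ bounded_fun u.

Definition supnorm u : R := sup (range (fun x => `|u x|)).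

Definition is_solution (alpha s eps : R) (D : set 'rV[R]_N) F u : Prop :=
  [/\ bounded_borel u,
      forall x, D x -> u x = A_op alpha s eps u x &
      forall x, ~ D x -> u x = F x].

End operator.

(* Main.v *)
Require Import Defs.
From mathcomp Require Import all_boot all_order all_algebra.
From mathcomp Require Import all_classical all_reals all_analysis.
From mathcomp Require Import measurable_realfun ring lra.
Import Order.TTheory GRing.Theory Num.Theory.
Import numFieldNormedType.Exports.
Local Open Scope classical_set_scope.
Local Open Scope ring_scope.
Set Implicit Arguments.
Unset Strict Implicit.
Unset Printing Implicit Defensive.

(** Write [A] for the averaging operator.  A jump from a point of the bounded
    set [D] that is longer than the diameter of [D] leaves [D], and inside
    every cone such jumps carry the same fixed fraction [l > 0] of the total
    mass: by homogeneity of the density, the dilation [z |-> L z] maps the cone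
    truncated at [eps] onto the one truncated at [L * eps] and multiplies its
    mass by [L `^ (- 2 s)], in every direction ([levy_open_cone_scale]).  Hence
    an average over a cone centred at a point of [D] of a function that is at
    most [K] everywhere and at most [0] off [D] is at most [(1 - l) * K]
    ([avg_le]).  Suprema and infima over directions preserve this one-sided
    bound, so
      [A u - A v <= (1 - l) * sup (u - v)^+]   on [D], if [u <= v] off [D]
    ([A_op_contract]).

    Everything follows from this strict contraction.  A subsolution that lies
    below a supersolution off [D] lies below it everywhere, since iterating the
    estimate gives [u - v <= (1 - l) ^+ n * K] for all [n] ([comparison]).
    Monotonicity, uniqueness and, by comparison with the constants
    [+- supnorm F], the norm bound are instances.  For existence, the iterates
    of [u |-> A u] on [D], [F] off [D], converge uniformly at a geometric rate
    ([dirichlet_exists]).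

    The iteration needs [A u] to be Borel, although it is defined by an
    uncountable supremum.  For a fixed direction [y] the average is Borel in
    [x] by Tonelli's theorem ([measurable_avg_shift]); for fixed [x] it depends
    continuously on [y], because the boundary of a cone is a null set
    ([lebesgue_rV_cone_boundary]) and dominated convergence applies
    ([cvg_avg]).  The supremum may therefore be restricted to countably many
    directions ([measurable_upper]).

    All of this takes place under a finite measure: the tail of the density
    beyond [eps] is integrable ([levy_measure_far_fin]), again by scaling. *)

(** * Euclidean geometry of row vectors *)


Section euclidean_geometry.
Context (R : realType) (N : nat).
Implicit Types y z v w : 'rV[R]_N.

Lemma dotpC y z : dotp y z = dotp z y.
Proof. by apply: eq_bigr => i _; rewrite mulrC. Qed.

Lemma dotpDr y z w : dotp y (z + w) = dotp y z + dotp y w.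
Proof. by rewrite -big_split; apply: eq_bigr => i _; rewrite mxE mulrDr. Qed.

Lemma dotpZr a y z : dotp y (a *: z) = a * dotp y z.
Proof. by rewrite mulr_sumr; apply: eq_bigr => i _; rewrite mxE mulrCA. Qed.

Lemma dotpDl y z w : dotp (z + w) y = dotp z y + dotp w y.
Proof. by rewrite !(dotpC _ y) dotpDr. Qed.

Lemma dotpZl a y z : dotp (a *: y) z = a * dotp y z.
Proof. by rewrite !(dotpC _ z) dotpZr. Qed.

Lemma dotp_ge0 z : 0 <= dotp z z.
Proof. by apply: sumr_ge0 => i _; rewrite -expr2 sqr_ge0. Qed.

Lemma enorm_ge0 z : 0 <= enorm z.
Proof. exact: sqrtr_ge0. Qed.

Lemma enorm_sqr z : enorm z ^+ 2 = dotp z z.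
Proof. by rewrite sqr_sqrtr// dotp_ge0. Qed.

Lemma enormZ a z : enorm (a *: z) = `|a| * enorm z.
Proof.
by rewrite /enorm dotpZl dotpZr mulrA -expr2 sqrtrM ?sqr_ge0// sqrtr_sqr.
Qed.

Lemma enorm_coord z i : `|z ord0 i| <= enorm z.
Proof.
rewrite -(ler_pXn2r (n := 2))// ?nnegrE ?enorm_ge0// enorm_sqr real_normK ?num_real//.
rewrite /dotp (bigD1 i)//= -expr2 lerDl; apply: sumr_ge0 => j _.
by rewrite -expr2 sqr_ge0.
Qed.

Lemma enorm_eq0 z : enorm z = 0 -> z = 0.
Proof.
move=> z0; apply/rowP => i; rewrite mxE; apply/eqP.
by rewrite -normr_le0 -z0 enorm_coord.
Qed.

Lemma dotp_le y z : dotp y z <= enorm y * enorm z.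
Proof.
have [/enorm_eq0->|y0] := eqVneq (enorm y) 0.
  by rewrite -(scale0r (0 : 'rV[R]_N)) dotpZl mul0r mulr_ge0// enorm_ge0.
have [/enorm_eq0->|z0] := eqVneq (enorm z) 0.
  by rewrite -(scale0r (0 : 'rV[R]_N)) dotpZr mul0r mulr_ge0// enorm_ge0.
have := dotp_ge0 (enorm z *: y - enorm y *: z).
rewrite -scaleNr !dotpDl !dotpDr !dotpZl !dotpZr -!enorm_sqr (dotpC z y).
set a := enorm y; set b := enorm z; set d := dotp y z => h.
have ab : 0 < a * b by rewrite mulr_gt0// lt_neqAle eq_sym ?y0 ?z0 enorm_ge0.
by rewrite -(ler_pM2l ab); nra.
Qed.

Lemma dotp_ge y z : - (enorm y * enorm z) <= dotp y z.
Proof.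
rewrite lerNl; have := dotp_le (- y) z.
by rewrite -scaleN1r dotpZl enormZ normrN1 mulN1r mul1r.
Qed.

Lemma enormD y z : enorm (y + z) <= enorm y + enorm z.
Proof.
rewrite -(ler_pXn2r (n := 2))// ?nnegrE ?addr_ge0 ?enorm_ge0//.
rewrite enorm_sqr dotpDl !dotpDr -!enorm_sqr (dotpC z y).
by have := dotp_le y z; nra.
Qed.

(** The inequality is written without division, so that it makes truncated
    cones visibly open and scales well under dilations. *)
Lemma angle_lt alpha y z : 0 < alpha <= pi / 2 -> enorm y = 1 -> 0 < enorm z ->
  (angle y z < alpha) = (cos alpha * enorm z < dotp y z).
Proof.
move=> /andP[a0 api] y1 z0; rewrite /angle y1 mul1r.
have pi0 := @pi_ge0 R.
have rB : -1 <= dotp y z / enorm z <= 1.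
  rewrite ler_pdivlMr// ler_pdivrMr// mulN1r mul1r.
  by have := dotp_ge y z; have := dotp_le y z; rewrite y1 mul1r => -> ->.
rewrite -[RHS]ltr_pdivlMr// -{2}(acosK rB) ltr_cos//.
- by rewrite in_itv/= acos_ge0// acos_lepi.
- by rewrite in_itv/= (ltW a0)/=; lra.
Qed.

Lemma coneE alpha eps y : 0 < alpha <= pi / 2 -> 0 <= eps -> enorm y = 1 ->
  cone alpha eps%:E +oo%E y =
  [set z | cos alpha * enorm z < dotp y z /\ eps < enorm z].
Proof.
move=> ha e0 y1; rewrite /cone; apply/seteqP; split => z /=; rewrite lte_fin ltry andbT => -[az ez].
  by rewrite -(angle_lt ha)// (le_lt_trans e0 ez).
by rewrite (angle_lt ha)// (le_lt_trans e0 ez).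
Qed.

Lemma cos_itv (alpha : R) : 0 < alpha <= pi / 2 -> 0 <= cos alpha < 1.
Proof.
move=> /andP[a0 api]; have pi0 := @pi_ge0 R.
rewrite cos_ge0_pihalf/=; last by lra.
by rewrite -cos0 ltr_cos// in_itv/=; lra.
Qed.

Lemma enorm_le_mxnorm z : enorm z <= N%:R * `|z|.
Proof.
have Nz : 0 <= N%:R * `|z| by rewrite mulr_ge0.
rewrite -(ler_pXn2r (n := 2))// ?nnegrE ?enorm_ge0// enorm_sqr.
have zi i : z ord0 i * z ord0 i <= `|z| ^+ 2.
  have : `|z ord0 i| <= `|z|.
    by rewrite [leRHS]mx_normrE; exact: (le_bigmax _ (fun ij => `|z ij.1 ij.2|) (ord0, i)).
  by move=> h; rewrite -expr2 -real_normK ?num_real// lerXn2r// nnegrE.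
apply: (le_trans (ler_sum _ (fun i _ => zi i))).
rewrite sumr_const card_ord -[_ ^+ 2 *+ _]mulr_natl exprMn ler_wpM2r ?sqr_ge0//.
by rewrite -natrX ler_nat; case: (N) => // n; rewrite expnS expn1 leq_pmulr.
Qed.

Lemma continuous_dotp (y : 'rV[R]_N) : continuous (dotp y).
Proof.
have addc : continuous (fun x : R * R => x.1 + x.2).
  by move=> w; exact: add_continuous.
have coordc i : xpredT i -> continuous (fun z : 'rV[R]_N => y ord0 i * z ord0 i).
  by move=> _ z; apply: continuousM; [exact: cst_continuous|exact: coord_continuous].
by move=> z; exact: (continuous_big addc coordc).
Qed.

Lemma continuous_enorm : continuous (@enorm R N).
Proof.
move=> z; apply: (@continuous_comp _ _ _ (fun z => dotp z z) (@Num.sqrt R)); last first.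
  exact: sqrt_continuous.
have addc : continuous (fun x : R * R => x.1 + x.2).
  by move=> w; exact: add_continuous.
have coordc i : xpredT i -> continuous (fun z : 'rV[R]_N => z ord0 i * z ord0 i).
  by move=> _ w; apply: continuousM; exact: coord_continuous.
exact: (continuous_big addc coordc).
Qed.

Lemma measurable_enorm_itv (i : interval R) :
  measurable [set z : 'rV[R]_N | enorm z \in i].
Proof.
by have := @measurable_enorm R N measurableT _ (measurable_itv i); rewrite setTI.
Qed.

Lemma measurable_enorm_gt (r : R) : measurable [set z : 'rV[R]_N | r < enorm z].
Proof.
have := measurable_enorm_itv `]r, +oo[.
by congr measurable; apply/seteqP; split => z /=; rewrite in_itv/= andbT.
Qed.

End euclidean_geometry.

(** * A countable dense family of directions *)

Section dense_directions.
Context (R : realType) (N : nat).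
Hypothesis N0 : (0 < N)%N.

(** Only the zero vector has no direction; a basis vector replaces it to keep
    the whole sequence on the sphere. *)
Definition rational_direction (k : nat) : 'rV[R]_N :=
  let v : 'rV[R]_N := map_mx ratr (odflt (0 : 'rV[rat]_N) (unpickle k)) in
  if enorm v == 0 then std_basis R N 1 else direction v.

Lemma std_basis1_sphere : sphere (std_basis R N 1).
Proof.
rewrite /sphere/= /enorm /dotp (bigD1 (Ordinal N0))//= !mxE eqxx mul1r.
rewrite big1 ?addr0 ?sqrtr1// => i iN; rewrite !mxE eqSS.
by case: eqP => //= i0; rewrite ?mul0r//; case/eqP: iN; exact/val_inj.
Qed.

Lemma rational_direction_sphere k : sphere (rational_direction k).
Proof.
rewrite /rational_direction; case: ifPn => [_|v0]; first exact: std_basis1_sphere.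
by rewrite /sphere/= /direction enormZ ger0_norm ?invr_ge0 ?enorm_ge0// mulVf.
Qed.

(** Convergence is tested through scalar products, the only way in which
    directions enter the cones. *)
Lemma rational_direction_dense (y : 'rV[R]_N) : sphere y -> exists k : nat -> nat,
  forall z, dotp (rational_direction (k n)) z @[n --> \oo] --> dotp y z.
Proof.
move=> y1.
have /choice[r hr] : forall n, exists r : 'rV[rat]_N,
    forall i, `|y ord0 i - ratr (r ord0 i)| < n.+1%:R^-1.
  move=> n; have /choice[q hq] : forall i, exists q : rat,
      `|y ord0 i - ratr q| < n.+1%:R^-1.
    move=> i; have n0 : (0 : R) < n.+1%:R^-1 by rewrite invr_gt0.
    have [q /itvP qi] := @rat_in_itvoo R (y ord0 i - n.+1%:R^-1)
      (y ord0 i + n.+1%:R^-1) ltac:(by rewrite ltrBlDr -addrA ltrDl addr_gt0).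
    by exists q; rewrite distrC ltr_distl !qi.
  by exists (\row_i q i) => i; rewrite mxE.
pose v n : 'rV[R]_N := map_mx ratr (r n).
have cv i : v n ord0 i @[n --> \oo] --> y ord0 i.
  apply/cvgrPdist_lt => e e0; near=> n.
  rewrite /v mxE (lt_trans (hr n i))//; near: n.
  exact: near_infty_natSinv_lt (PosNum e0).
have cd (w : nat -> 'rV[R]_N) (w' : 'rV[R]_N) :
    (forall i, w n ord0 i @[n --> \oo] --> w' ord0 i) ->
    dotp (v n) (w n) @[n --> \oo] --> dotp y w'.
  by move=> cw; apply: cvg_big; [exact: add_continuous|move=> i _; exact: cvgM].
have cn : enorm (v n) @[n --> \oo] --> (1 : R).
  have y1' : enorm y = 1 := y1.
  rewrite -y1'; apply: (@continuous_cvg _ _ _ _ _ (fun n => dotp (v n) (v n))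
    (@Num.sqrt R) (dotp y y)); last exact: cd.
  exact: sqrt_continuous.
exists (fun n => pickle (r n)) => z.
have -> : dotp y z = 1^-1 * dotp y z by rewrite invr1 mul1r.
have : (enorm (v n))^-1 * dotp (v n) z @[n --> \oo] --> 1^-1 * dotp y z.
  apply: cvgM; first by apply: cvgV => //; exact: oner_neq0.
  by apply: cd => i; exact: cvg_cst.
apply: cvg_trans; apply: near_eq_cvg; near=> n.
have : 0 < enorm (v n).
  by near: n; move/cvgrPdist_lt: cn => /(_ 1 ltr01); apply: filterS => n;
  rewrite ltr_norml => /andP[_]; lra.
rewrite lt_neqAle eq_sym => /andP[v0 _].
by rewrite /rational_direction pickleK/= -/(v n) (negbTE v0) /direction dotpZl.
Unshelve. all: by end_near. Qed.

End dense_directions.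

(** * Lebesgue measure under homotheties and translations *)

Section lebesgue_affine.
Context (R : realType).
Local Open Scope ereal_scope.

Lemma measurable_affine (a b : R) :
  measurable_fun setT (fun x : measurableTypeR R => (a * x + b)%R : measurableTypeR R).
Proof.
apply: measurable_funD => //; exact: measurable_funM.
Qed.

Lemma measurable_affine_rV n (a : R) (w : 'rV[R]_n) :
  measurable_fun setT (fun v : 'rV[R]_n => a *: v + w)%R.
Proof.
apply: measurable_fun_rV => i; under eq_fun do rewrite !mxE.
by apply: measurable_funD => //; apply: measurable_funM => //; exact: measurable_coord.
Qed.

Lemma lebesgue_measure_affine (a b : R) (A : set (measurableTypeR R)) :
  (0 < a)%R -> measurable A ->
  lebesgue_measure ((fun x => a * x + b)%R @^-1` A) =
  a^-1%:E * lebesgue_measure A.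
Proof.
move=> a0 mA.
have a'0 : (0 <= a)%R by exact: ltW.
pose m : {measure set (measurableTypeR R) -> \bar R} :=
  mscale (NngNum a'0)
   (measure_function_pushforward__canonical__measure_function_Measure
     (@lebesgue_measure R) (measurable_affine a b)).
rewrite (@lebesgue_measure_unique _ m _ A)//.
  by rewrite /m/= /mscale/= /pushforward muleA -EFinM mulVf ?gt_eqF// mul1e.
move=> _ [[p q] _ <-]; rewrite /m/= /mscale/= /pushforward.

have -> : (fun x => a * x + b)%R @^-1` [set` `]p, q]%R] =
    [set` `]((p - b) / a)%R, ((q - b) / a)%R]%R].
  apply/seteqP; split => x /=; rewrite !in_itv/= ltr_pdivrMr// ler_pdivlMr//;
  by rewrite ltrBlDr lerBrDr (mulrC x).
rewrite !lebesgue_measure_itv/= !lte_fin ltr_pM2r ?invr_gt0// ltrD2r.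
case: ifPn => _; last by rewrite mule0.
by rewrite -!EFinD -EFinM; congr (_%:E); field; rewrite gt_eqF.
Qed.

Lemma uncons_rVK n : cancel (@uncons_rV R n) (@cons_rV R n).
Proof.
move=> v; apply: (etrans _ (@hsubmxK _ 1 1 n v)).
congr (row_mx _ _); apply/rowP => j.
by rewrite !mxE ord1; congr (v _ _); exact/val_inj.
Qed.

Lemma cons_rV_affine n a b x (c v : 'rV[R]_n) :
  (a *: cons_rV (x, v) + cons_rV (b, c) = cons_rV (a * x + b, a *: v + c))%R.
Proof.
rewrite /cons_rV/=; set k := const_mx x; set l := const_mx b.
apply: (etrans (y := row_mx (a *: k + l) (a *: v + c) : 'rV_(1 + n)))%R.
  by rewrite -add_row_mx -scale_row_mx.
by congr (row_mx _ _); apply/rowP => j; rewrite !mxE.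
Qed.

(** Dilations and translations are treated together because both are needed
    and the class of maps [v |-> a v + w] is stable under splitting off the
    first coordinate: uniqueness of product measures then reduces the claim to
    dimension one. *)
Lemma lebesgue_rV_affine n (a : R) (w : 'rV[R]_n) (A : set 'rV[R]_n) :
  (0 < a)%R -> measurable A ->
  lebesgue_rV ((fun v => a *: v + w)%R @^-1` A) = (a ^- n)%:E * lebesgue_rV A.
Proof.
move=> a0; elim: n w A => [|n IH] w A mA.
  rewrite expr0 invr1 mul1e /= !diracE; congr (_%:E); congr (_%:R); congr nat_of_bool.
  apply/idP/idP; rewrite !inE/=.
    by rewrite (_ : a *: 0 + w = 0)%R//; apply/rowP => -[].
  by rewrite (_ : a *: 0 + w = 0)%R//; apply/rowP => -[].
have an0 : (0 <= a ^+ n.+1)%R by rewrite exprn_ge0// ltW.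
rewrite -[w]uncons_rVK; case: (uncons_rV w) => b c.
pose phi (p : measurableTypeR R * 'rV[R]_n) : measurableTypeR R * 'rV[R]_n :=
  (a * p.1 + b, a *: p.2 + c)%R.
have mphi : measurable_fun setT phi.
  apply: measurable_fun_pair.
    exact: (measurableT_comp (measurable_affine a b)).
  exact: (measurableT_comp (measurable_affine_rV a c)).
pose P : {measure set (measurableTypeR R * 'rV[R]_n) -> \bar R} :=
  @lebesgue_measure R \x @lebesgue_rV R n.
pose m : {measure set (measurableTypeR R * 'rV[R]_n) -> \bar R} :=
  mscale (NngNum an0)
   (measure_function_pushforward__canonical__measure_function_Measure P mphi).
have mcA : measurable (@cons_rV R n @^-1` A).
  by rewrite -[X in measurable X]setTI; apply: measurable_cons_rV.
have PE : P (@cons_rV R n @^-1` A) = m (@cons_rV R n @^-1` A).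
  apply: product_measure_unique => //= B C mB mC.
  rewrite /m/= /mscale/= /pushforward.
  pose B' := (fun x => a * x + b)%R @^-1` B.
  pose C' := (fun v => a *: v + c)%R @^-1` C.
  have -> : P (phi @^-1` (B `*` C)) = lebesgue_measure B' * lebesgue_rV C'.
    apply: product_measure1E.
    - by rewrite -[X in measurable X]setTI; exact: measurable_affine.
    - by rewrite -[X in measurable X]setTI; exact: measurable_affine_rV.
  rewrite /B' /C' lebesgue_measure_affine// IH//.
  rewrite muleACA !muleA -!EFinM -[RHS]mul1e [RHS]muleA; congr (_%:E * _ * _).
  by rewrite exprS; field; rewrite ?expf_neq0// gt_eqF.
transitivity (P (phi @^-1` (@cons_rV R n @^-1` A))).
  rewrite /= /pushforward; congr (P _); apply/seteqP.
  by split => -[x v] /=; rewrite cons_rV_affine.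
rewrite [RHS](_ : _ = (a ^- n.+1)%:E * P (@cons_rV R n @^-1` A))//.
rewrite PE /m/= /mscale/= /pushforward muleA -EFinM mulVf ?mul1e//.
by rewrite expf_neq0// gt_eqF.
Qed.
End lebesgue_affine.

(** * Bounded sets, open sets and boundaries of cones *)

Section boxes.
Context (R : realType).

Definition box n (r : R) : set 'rV[R]_n := [set v | forall i, `|v ord0 i| < r].

Lemma measurable_box n (r : R) : measurable (@box n r).
Proof.
have -> : @box n r = \bigcap_(i in [set: 'I_n])
    ((fun v : 'rV[R]_n => `|v ord0 i|) @^-1` `]-oo, r[%classic).
  apply/seteqP; split => v /= h i; first by move=> _; rewrite /= in_itv/=.
  by have := h i I; rewrite /= in_itv.
apply: fin_bigcap_measurable => // i _; rewrite -[X in measurable X]setTI.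
have mi : measurable_fun setT (fun v : 'rV[R]_n => `|v ord0 i|).
  by apply: measurableT_comp => //; exact: measurable_coord.
exact: mi.
Qed.

Lemma lebesgue_rV_box n (r : R) : 0 < r ->
  lebesgue_rV (@box n r) = ((2 * r) ^+ n)%:E.
Proof.
move=> r0; elim: n => [|n IH].
  by rewrite expr0/= diracE mem_set// => -[].
transitivity ((@lebesgue_measure R \x @lebesgue_rV R n)%E
  (`]- r, r[%classic `*` @box n r)).
  rewrite /= /pushforward; congr ((_ \x _)%E _).
  apply/seteqP; split => -[x v] /=.
    move=> h; split.
      have := h ord0; rewrite /cons_rV/= in_itv/= -ltr_norml.
      have -> : ord0 = lshift n (ord0 : 'I_1) :> 'I_(1 + n) by exact/val_inj.
      by rewrite (row_mxEl (const_mx x : 'rV[R]_1) v) mxE.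
    move=> i; have := h (rshift 1 i).
    by rewrite /cons_rV/= (row_mxEr (const_mx x : 'rV[R]_1) v).
  rewrite in_itv/= -ltr_norml => -[hx hv] i.
  case: (split_ordP (i : 'I_(1 + n))) => j ->.
    by rewrite /cons_rV/= (row_mxEl (const_mx x : 'rV[R]_1) v) mxE.
  by rewrite /cons_rV/= (row_mxEr (const_mx x : 'rV[R]_1) v).
transitivity (@lebesgue_measure R ([set` `]- r, r[] : set R)%R * lebesgue_rV (@box n r))%E.
  by apply: product_measure1E => //; exact: measurable_box.
rewrite IH lebesgue_measure_itv/= lte_fin -EFinD opprK.
by rewrite ifT ?exprS -?EFinM ?mulr2n ?mulrDl ?mul1r//; lra.
Qed.

Lemma lebesgue_rV_enorm_fin n (r : R) :
  (lebesgue_rV [set z : 'rV[R]_n | (enorm z <= r)%R] < +oo)%E.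
Proof.
have m : measurable [set z : 'rV[R]_n | enorm z <= r].
  by have := @measurable_enorm R n measurableT _ (measurable_itv `]-oo, r]);
    rewrite setTI; congr measurable; apply/seteqP; split => z /=; rewrite in_itv.
apply: (@le_lt_trans _ _ (lebesgue_rV (@box n (`|r| + 1)))); last first.
  by rewrite lebesgue_rV_box ?ltry// ltr_wpDl.
apply: le_measure; rewrite ?inE//; first exact: measurable_box.
move=> z /= zr i; rewrite (le_lt_trans (enorm_coord _ _))// (le_lt_trans zr)//.
by rewrite (le_lt_trans (ler_norm _))// ltrDl.
Qed.

Lemma lebesgue_rV_open_gt0 n (U : set 'rV[R]_n) :
  open U -> U !=set0 -> (0 < lebesgue_rV U)%E.
Proof.
move=> oU [x Ux].
have /nbhs_ballP [e /= e0 eU] : nbhs x U by exact: open_nbhs_nbhs.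
have sub : (fun v : 'rV[R]_n => 1 *: v + (- x)) @^-1` @box n e `<=` U.
  move=> v /= h; apply: eU; split => // a b; rewrite (ord1 a) /ball/= distrC.
  by have := h b; rewrite !mxE mul1r.
apply: (@lt_le_trans _ _ (lebesgue_rV ((fun v : 'rV[R]_n => 1 *: v + (- x)) @^-1` @box n e))).
  rewrite lebesgue_rV_affine//; last exact: measurable_box.
  by rewrite expr1n invr1 mul1e lebesgue_rV_box// lte_fin exprn_gt0// mulr_gt0.
apply: le_measure sub; rewrite ?inE//; last exact: open_measurable_rV.
by rewrite -[X in measurable X]setTI; apply: measurable_affine_rV => //; exact: measurable_box.
Qed.

End boxes.

Section cone_boundary.
Context (R : realType) (N : nat).

Lemma measurable_cone_boundary (c : R) (y : 'rV[R]_N) :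
  measurable [set z | c * enorm z = dotp y z].
Proof.
have h : measurable_fun setT (fun z => c * enorm z - dotp y z).
  apply: measurable_funB; last exact: measurable_dotp.
  by apply: measurable_funM => //; exact: measurable_enorm.
have := h measurableT _ (measurable_set1 (0 : R)).
rewrite setTI; congr measurable; apply/seteqP; split => z /=.
  by move=> /eqP; rewrite subr_eq0 => /eqP.
by move=> ->; rewrite subrr.
Qed.

(** Since [c < 1], the function [t |-> <y, z + t y> - c |z + t y|] is strictly
    increasing, so each line of direction [y] meets the boundary [B] of the cone
    in at most one point.  By Tonelli applied to
    [{(t, z) | z + t y \in B}], the integral over [t \in R] of the measure of
    [B - t y] vanishes; by translation invariance this integral is [+oo] times
    the measure of [B]. *)
Lemma lebesgue_rV_cone_boundary (c : R) (y : 'rV[R]_N) :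
  0 <= c < 1 -> enorm y = 1 -> lebesgue_rV [set z | c * enorm z = dotp y z] = 0.
Proof.
move=> /andP[c0 c1] y1; set B := [set z | _].
have mB : measurable B by exact: measurable_cone_boundary.
pose S : set (measurableTypeR R * 'rV[R]_N) := [set p | B (1 *: p.2 + p.1 *: y)].
have mS : measurable S.
  have mf : measurable_fun setT
      (fun p : measurableTypeR R * 'rV[R]_N => 1 *: p.2 + p.1 *: y).
    apply: measurable_fun_rV => i; under eq_fun do rewrite !mxE mul1r.
    apply: measurable_funD.
      by apply: (measurableT_comp (@measurable_coord R N i)); exact: measurable_snd.
    by apply: measurable_funM => //; exact: measurable_fst.
  by rewrite -[X in measurable X]setTI; exact: mf.
have := @indic_fubini_tonelli _ _ _ _ _ (@lebesgue_measure R) (@lebesgue_rV R N) S mS.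
rewrite indic_fubini_tonelli_FE// indic_fubini_tonelli_GE//.
rewrite [LHS](_ : _ = (\int[@lebesgue_measure R]_x (cst (lebesgue_rV B) x))%E); last first.
  apply: eq_integral => t _ /=.
  rewrite (_ : xsection S t = (fun z => 1 *: z + t *: y) @^-1` B); last first.
    by apply/seteqP; split => z; rewrite /xsection/= inE.
  by rewrite lebesgue_rV_affine// expr1n invr1 mul1e.
rewrite integral_cst// [X in _ = X -> _]integral0_eq; last first.
  move=> z _ /=.
  (* A point of the boundary cannot be moved along [y] within the boundary. *)
  have uniq t t' : ysection S z t -> ysection S z t' -> ~ (t < t').
    rewrite /ysection/= !inE /S/B/= !scale1r => Bt Bt' tt'.
    have := enormD (z + t *: y) ((t' - t) *: y).
    rewrite enormZ y1 mulr1 gtr0_norm ?subr_gt0// -addrA -scalerDl [t + _]addrC subrK.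
    move: Bt Bt'; rewrite !dotpDr !dotpZr -enorm_sqr y1 expr1n !mulr1.
    nra.
  have [->|/set0P[t St]] := eqVneq (ysection S z) set0; first by rewrite measure0.
  rewrite (_ : ysection S z = [set t]) ?lebesgue_measure_set1//.
  apply/seteqP; split => [t' St'|t' ->//] /=.
  have := uniq _ _ St' St; have := uniq _ _ St St'.
  by have [||//] := ltgtP t t'.
move=> /eqP; rewrite mule_eq0 => /orP[/eqP //|].
rewrite [X in X == _](_ : _ = +oo%E)//.
transitivity (@lebesgue_measure R [set` `]-oo, +oo[%R]); last first.
  by rewrite lebesgue_measure_itv.
by rewrite set_itvE.
Qed.

End cone_boundary.

(** * The jump measure: scaling, finite tails, null and open sets *)

Section levy_measure_theory.
Context (R : realType) (N : nat) (s : R).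
Hypothesis s0 : 0 < s.
Let s_ge0 : 0 <= s := ltW s0.
Implicit Types (A : set 'rV[R]_N).

Lemma measurable_levy_density_EFin A :
  measurable_fun A (fun z => (levy_density s z)%:E).
Proof.
apply: (@measurable_funS _ _ _ _ setT) => //.
by apply/measurable_EFinP; exact: measurable_levy_density.
Qed.

(** The density is homogeneous of degree [- (N + 2 s)] and Lebesgue measure of
    degree [N]. *)
Lemma levy_measure_scale (l : R) A : 0 < l -> measurable A ->
  levy_measure s ((fun z => l *: z) @^-1` A) = ((l `^ (2 * s))%:E * levy_measure s A)%E.
Proof.
move=> l0 mA; have l_ge0 := ltW l0.
have m0 : measurable_fun setT (fun z : 'rV[R]_N => l *: z).
  have := @measurable_affine_rV R N l 0.
  by congr measurable_fun; apply/funext => z; rewrite addr0.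
have q0 : 0 <= l `^ (N%:R + 2 * s) by exact: powR_ge0.
have lN0 : 0 <= l ^- N by rewrite invr_ge0 exprn_ge0.
have dE (z : 'rV[R]_N) : (levy_density s z)%:E =
    ((l `^ (N%:R + 2 * s))%:E * (levy_density s (l *: z))%:E)%E.
  rewrite -EFinM /levy_density enormZ gtr0_norm// powRM ?enorm_ge0//.
  rewrite invfM [X in _ = X%:E]mulrCA mulVKf//.
  by rewrite gt_eqF// powR_gt0.
have d0 (z : 'rV[R]_N) : (0 <= (levy_density s z)%:E)%E.
  by rewrite lee_fin levy_density_ge0.
have mphiA : measurable ((fun z : 'rV[R]_N => l *: z) @^-1` A).
  by rewrite -[X in measurable X]setTI; exact: m0.
have md : measurable_fun ((fun z : 'rV[R]_N => l *: z) @^-1` A)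
    (fun z => (levy_density s (l *: z))%:E).
  apply: (@measurable_funS _ _ _ _ setT) => //.
  apply: (@measurableT_comp _ _ _ _ _ _ (fun z => (levy_density s z)%:E)) => //.
  exact: measurable_levy_density_EFin.
rewrite /levy_measure; under eq_integral do rewrite dE.
rewrite (ge0_integralZl_EFin _ mphiA (fun z _ => d0 (l *: z)) md q0).
rewrite -(@ge0_integral_pushforward _ _ _ _ _ _ m0 (@lebesgue_rV R N) A
  (fun z => (levy_density s z)%:E) mA (@measurable_levy_density_EFin _) (fun z _ => d0 z)).
rewrite (@eq_measure_integral _ _ _ _ (mscale (NngNum lN0) (@lebesgue_rV R N))).
  rewrite (ge0_integral_mscale _ mA _ (@measurable_levy_density_EFin _)
    (fun z _ => d0 z)).
  rewrite muleA -EFinM; congr (_%:E * _)%E => /=.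
  rewrite powRD; last by apply/implyP => _; rewrite gt_eqF.
  by rewrite powR_mulrn// mulrAC mulfV ?mul1r// expf_neq0// gt_eqF.
move=> B mB _; rewrite /= /mscale/= -(lebesgue_rV_affine 0 l0 mB).
rewrite /pushforward; congr lebesgue_rV; apply/seteqP.
by split => z /=; rewrite addr0.
Qed.

Lemma levy_measure_shell_fin (a b : R) : 0 < a ->
  (levy_measure s [set z : 'rV[R]_N | (enorm z \in `]a, b])%R] < +oo)%E.
Proof.
move=> a0; set A := [set z | _].
have mA : measurable A by exact: measurable_enorm_itv.
pose k := levy_const N s / a `^ (N%:R + 2 * s).
have k0 : 0 <= k.
  by rewrite /k divr_ge0 ?powR_ge0// divr_ge0// ?mulr_ge0 ?powR_ge0 ?Gamma_ge0.
apply: (@le_lt_trans _ _ (k%:E * lebesgue_rV A)%E); last first.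
  apply: lte_mul_pinfty; rewrite ?lee_fin//.
  apply: le_lt_trans (@lebesgue_rV_enorm_fin R N b).
  apply: le_measure; rewrite ?inE//.
    have := @measurable_enorm_itv R N `]-oo, b].
    by congr measurable; apply/seteqP; split => z /=; rewrite in_itv.
  by move=> z; rewrite /A/= in_itv/= => /andP[].
rewrite -integral_cst//; apply: ge0_le_integral => //.
- by move=> z _; rewrite lee_fin levy_density_ge0.
- exact: measurable_levy_density_EFin.
- move=> z; rewrite /A/= in_itv/= => /andP[az _].
  rewrite lee_fin /levy_density ler_wpM2l//.
    by rewrite divr_ge0// ?mulr_ge0 ?powR_ge0 ?Gamma_ge0.
  have z0 := lt_trans a0 az.
  rewrite lef_pV2 ?posrE ?powR_gt0// ge0_ler_powR// ?nnegrE ?(ltW a0) ?(ltW z0) ?(ltW az)//.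
  by rewrite addr_ge0// mulr_ge0.
Qed.

(** Let [x n] be the mass of [{e < |z| <= 2 ^+ n * e}], [a = x 1] and
    [t = 2 `^ (- 2 s) < 1].  Dilation by [2] gives [x n.+1 <= a + t * x n], so
    all the [x n] are bounded by [a / (1 - t)], and the tail is their limit. *)
Lemma levy_measure_far_fin (e : R) : 0 < e ->
  (levy_measure s [set z : 'rV[R]_N | (e < enorm z)%R] < +oo)%E.
Proof.
move=> e0; have [m mE] := @levy_measureP R N s s_ge0.
pose sh n : set 'rV[R]_N := [set z | enorm z \in `]e, 2 ^+ n * e]].
have msh n : measurable (sh n) by exact: measurable_enorm_itv.
have shE : [set z : 'rV[R]_N | e < enorm z] = \bigcup_n sh n.
  apply/seteqP; split => z /=; last first.
    by move=> [n _]; rewrite /sh/= in_itv/= => /andP[].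
  move=> ez; exists (Num.bound (enorm z / e)) => //; rewrite /sh/= in_itv/= ez/=.
  rewrite -ler_pdivrMr//.
  have /ltW/le_trans := archi_boundP (divr_ge0 (enorm_ge0 z) (ltW e0)); apply.
  by rewrite -natrX ler_nat ltnW// ltn_expl.
have ndsh : nondecreasing_seq sh.
  move=> i j ij; apply/subsetPset => z; rewrite /sh/= !in_itv/= => /andP[-> /=].
  by move/le_trans; apply; rewrite ler_pM2r// ler_eXn2l// ltr1n.
set t : R := (2 `^ (2 * s))^-1.
have t2 : 1 < 2 `^ (2 * s).
  have one : 1 `^ (2 * s) = 1 :> R by rewrite powR1.
  rewrite -[ltLHS]one gt0_ltr_powR ?nnegrE// ?mulr_gt0//.
  by rewrite ltr1n.
have t0 : 0 < t by rewrite invr_gt0 (lt_trans ltr01).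
have t1 : t < 1 by rewrite invf_lt1// (lt_trans ltr01).
set a := fine (m (sh 1%N)).
have aE : (m (sh 1%N) = a%:E)%E.
  rewrite /a fineK// ge0_fin_numE ?measure_ge0// mE.
  exact: levy_measure_shell_fin.
have a0 : 0 <= a by rewrite fine_ge0.
have bnd n : (m (sh n) <= (a / (1 - t))%:E)%E.
  elim: n => [|n IH].
    rewrite (_ : sh 0%N = set0) ?measure0 ?lee_fin ?divr_ge0 ?subr_ge0 ?(ltW t1)//.
    apply/seteqP; split => // z; rewrite /sh/= in_itv/= expr0 mul1r => /andP[].
    by move=> /lt_le_trans/[apply]; rewrite ltxx.
  (* What lies beyond the first shell is the dilate of [sh n] by 2. *)
  pose far : set 'rV[R]_N := [set z | enorm z \in `]2 * e, 2 ^+ n.+1 * e]].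
  have mfar : measurable far by exact: measurable_enorm_itv.
  have farE : (m far = t%:E * m (sh n))%E.
    rewrite mE (_ : sh n = (fun z => 2 *: z) @^-1` far).
      rewrite levy_measure_scale// muleA -EFinM mulVf ?mul1e// gt_eqF.
    apply/seteqP; split => z; rewrite /sh/far/= !in_itv/= enormZ ger0_norm//;
    by rewrite exprS -mulrA ltr_pM2l// ler_pM2l.
  have le1 : (m (sh 1%N) + m far <= (a / (1 - t))%:E)%E.
    rewrite aE farE; apply: (@le_trans _ _ (a%:E + t%:E * (a / (1 - t))%:E)%E).
      by rewrite leeD2l// lee_pmul2l// ?lte_fin.
    rewrite -EFinM -EFinD lee_fin le_eqVlt; apply/orP; left; apply/eqP.
    by field; rewrite subr_eq0 gt_eqF.
  have : sh n.+1 `<=` sh 1%N `|` far.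
    move=> z; rewrite /sh/far/= !in_itv/= expr1 => /andP[-> ->].
    by rewrite andbT/=; case: (leP (enorm z)); [left|right].
  move=> /(le_measure m); rewrite !inE => /(_ (msh _) (measurableU _ _ (msh _) mfar)).
  by move/le_trans; apply; apply: (le_trans (measureU2 _ _ _)).
have cv := nondecreasing_cvg_mu (mu := m) msh (bigcupT_measurable _ msh) ndsh.
rewrite -mE shE; apply: (@le_lt_trans _ _ (a / (1 - t))%:E); last exact: ltry.
rewrite -(cvg_lim _ cv)//; apply: lime_le; first by apply/cvg_ex; eexists; exact: cv.
by apply: nearW => n; exact: bnd.
Qed.

Lemma levy_measure_null A : measurable A ->
  lebesgue_rV A = 0%E -> levy_measure s A = 0%E.
Proof.
move=> mA A0; apply: (null_set_integral (mu := @lebesgue_rV R N)) => //.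
exact: measurable_levy_density_EFin.
Qed.

Lemma levy_measure_open_gt0 A : levy_const N s != 0 -> open A -> A !=set0 ->
  (forall z, A z -> 0 < enorm z) -> (0 < levy_measure s A)%E.
Proof.
move=> C0 oA An A0; have mA := open_measurable_rV oA.
have [m mE] := @levy_measureP R N s s_ge0.
rewrite lt_neqAle -{2}mE measure_ge0 andbT eq_sym; apply/eqP => mA0.
have : ae_eq (@lebesgue_rV R N) A (fun z => (levy_density s z)%:E) (cst 0%E).
  apply/(ae_eq_integral_abs _ mA); first exact: measurable_levy_density_EFin.
  rewrite -[RHS]mA0; apply: eq_integral => z _.
  by rewrite gee0_abs// lee_fin levy_density_ge0.
move=> [B [mB B0 AB]].
have := lebesgue_rV_open_gt0 oA An; apply/negP; rewrite -leNgt -B0.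
apply: le_measure; rewrite ?inE// => z Az; apply: AB => /= /(_ Az)/eqP.
rewrite eqe mulf_eq0 (negbTE C0)/= invr_eq0 gt_eqF//.
by rewrite powR_gt0// A0.
Qed.

Lemma levy_measure_const0 A : levy_const N s = 0 -> levy_measure s A = 0%E.
Proof.
by move=> C0; apply: integral0_eq => z _; rewrite /levy_density C0 mul0r.
Qed.

End levy_measure_theory.

(** * Bounded Borel functions *)

Section bounded_borel_functions.
Context (R : realType) (N : nat).
Implicit Types (u v : 'rV[R]_N -> R).

Lemma bounded_borelP u : bounded_borel u <->
  measurable_fun setT u /\ exists M, forall x, `|u x| <= M.
Proof.
split=> -[mu]; [move=> [M [_ bM]]|move=> [M bM]]; split => //.
  by exists (M + 1) => x; apply: bM => //; rewrite ltrDl.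
exists M; split; first exact: num_real.
by move=> y My x _; exact: le_trans (ltW My).
Qed.

Lemma bounded_borelB u v : bounded_borel u -> bounded_borel v ->
  bounded_borel (fun x => u x - v x).
Proof.
move=> /bounded_borelP[mu [M uM]] /bounded_borelP[mv [K vK]].
apply/bounded_borelP; split; first exact: measurable_funB.
by exists (M + K) => x; rewrite (le_trans (ler_normB _ _))// lerD.
Qed.

Lemma bounded_borelN u : bounded_borel u -> bounded_borel (fun x => - u x).
Proof.
move=> /bounded_borelP[mu [M uM]]; apply/bounded_borelP; split.
  exact: measurableT_comp.
by exists M => x; rewrite normrN.
Qed.

Lemma bounded_borel_cst (c : R) : bounded_borel (fun _ : 'rV[R]_N => c).
Proof. by apply/bounded_borelP; split => //; exists `|c|. Qed.

Lemma measurable_shift : measurable_fun setT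
  (fun p : 'rV[R]_N * 'rV[R]_N => p.1 + p.2).
Proof.
apply: measurable_fun_rV => i; under eq_fun do rewrite !mxE.
apply: measurable_funD; apply: (measurableT_comp (@measurable_coord R N i)).
  exact: measurable_fst.
exact: measurable_snd.
Qed.

Lemma bounded_borel_shift u x : bounded_borel u ->
  bounded_borel (fun z => u (x + z)).
Proof.
move=> /bounded_borelP[mu [M uM]]; apply/bounded_borelP; split; last by exists M.
apply: (measurableT_comp mu).
exact: (measurableT_comp measurable_shift (measurable_pair1 x)).
Qed.

End bounded_borel_functions.

(** * Averages with respect to a finite measure *)

Section averages.
Context (R : realType) (N : nat).
Variable nu : {finite_measure set 'rV[R]_N -> \bar R}.
Implicit Types (T : set 'rV[R]_N) (f g u : 'rV[R]_N -> R).

Definition avg T f : R := (\int[nu]_(z in T) f z) / fine (nu T).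

Lemma fin_nu T : measurable T -> (nu T < +oo)%E.
Proof. by move=> mT; rewrite -ge0_fin_numE// fin_num_measure. Qed.

Lemma integrable_bounded_borel T f : measurable T -> bounded_borel f ->
  nu.-integrable T (EFin \o f).
Proof.
move=> mT /bounded_borelP[mf [M fM]].
apply: measurable_bounded_integrable => //; first exact: fin_nu.
  exact: measurable_funS mf.
exists M; split; first exact: num_real.
by move=> y My x _; exact: le_trans (ltW My).
Qed.

Lemma avgB T f g : measurable T -> bounded_borel f -> bounded_borel g ->
  avg T (fun z => f z - g z) = avg T f - avg T g.
Proof.
by move=> mT bf bg; rewrite /avg RintegralB ?mulrBl//; exact: integrable_bounded_borel.
Qed.

Lemma avgN T f : measurable T -> bounded_borel f ->
  avg T (fun z => - f z) = - avg T f.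
Proof.
move=> mT bf; rewrite /avg -mulNr -[in RHS]mulN1r -RintegralZl//.
  by congr (_ / _); apply: eq_Rintegral => z _; rewrite mulN1r.
exact: integrable_bounded_borel.
Qed.

(** The part of [T] in [far] contributes at most [0] to the integral and the
    rest at most [K] times its mass.  When [T] is a null set the average is
    [0], which satisfies the bound as well. *)
Lemma avg_le T (far : set 'rV[R]_N) f (K l : R) :
  measurable T -> measurable far -> bounded_borel f -> 0 <= K -> l <= 1 ->
  nu (T `&` far) = (l%:E * nu T)%E ->
  (forall z, f z <= K) -> (forall z, far z -> f z <= 0) ->
  avg T f <= (1 - l) * K.
Proof.
move=> mT mfar bf K0 l1 nul fK f0; rewrite /avg.
have mn : measurable (~` far) by exact: measurableC.
have nuT : nu (T `\` far) = ((1 - l) * fine (nu T))%:E.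
  have -> : nu (T `\` far) = (nu T - nu (T `&` far))%E.
    by apply: measureD => //; exact: fin_nu.
  by rewrite nul -{1 2}(fineK (fin_num_measure nu T mT)) -EFinM -EFinB mulrBl mul1r.
have [->|T0] := eqVneq (fine (nu T)) 0.
  by rewrite invr0 mulr0 mulr_ge0// subr_ge0.
have T_gt0 : 0 < fine (nu T) by rewrite lt_neqAle eq_sym T0 fine_ge0.
rewrite ler_pdivrMr// mulrAC -[(1 - l) * fine _]/(fine ((1 - l) * fine (nu T))%:E).
rewrite -nuT mulrC setDE -Rintegral_cst; last exact: measurableI.
rewrite Rintegral_mkcondr; apply: le_Rintegral => //.
- exact: integrable_bounded_borel.
- apply: integrable_bounded_borel => //; apply/bounded_borelP; split.
    exact/(measurable_restrictT _ mn).
  by exists `|K| => z; rewrite patchE; case: ifP => // _; rewrite normr0.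
- move=> z Tz; rewrite patchE; case: ifPn => [_//|].
  by rewrite notin_setE => /contrapT /f0.
Qed.

(** Tonelli requires a nonnegative integrand, whence the shift of [u] by a
    bound [M] of its absolute value. *)
Lemma measurable_avg_shift T u : measurable T -> bounded_borel u ->
  measurable_fun setT (fun x : 'rV[R]_N => avg T (fun z => u (x + z))).
Proof.
move=> mT bu; have [mu [M uM]] := (bounded_borelP u).1 bu.
pose g (p : 'rV[R]_N * 'rV[R]_N) : R := (u (p.1 + p.2) - - M) * \1_T p.2.
have g0 p : (0 <= (g p)%:E)%E.
  rewrite lee_fin mulr_ge0// opprK -lerBlDr sub0r.
  by have := uM (p.1 + p.2); rewrite ler_norml => /andP[].
have mg : measurable_fun setT (EFin \o g).
  apply/measurable_EFinP; apply: measurable_funM.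
    by apply: measurable_funB => //; exact: (measurableT_comp mu (@measurable_shift R N)).
  by apply: (measurableT_comp (measurable_indic mT)); exact: measurable_snd.
have mF : measurable_fun setT (fun x : 'rV[R]_N => fine (fubini_F nu (EFin \o g) x)).
  apply: measurableT_comp => //.
  exact: (measurable_fun_fubini_tonelli_F (EFin \o g) mg g0).
have -> : (fun x => avg T (fun z => u (x + z))) = (fun x =>
    fine (fubini_F nu (EFin \o g) x) / fine (nu T) + avg T (fun=> - M)).
  apply/funext => x; have bx := bounded_borel_shift x bu.
  apply/eqP; rewrite -subr_eq -avgB//; last exact: bounded_borel_cst.
  rewrite /avg Rintegral_mkcond /Rintegral /fubini_F.
  apply/eqP; congr (fine _ / _); apply: eq_integral => z _.
  by rewrite patchE /g/= indicE; case: ifPn => _; rewrite ?mulr1 ?mulr0.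
by apply: measurable_funD => //; exact: measurable_funM.
Qed.

(** Both the numerator and, taking [f = 1], the denominator of the average
    converge by dominated convergence. *)
Lemma cvg_avg (T_ : nat -> set 'rV[R]_N) T f :
  (forall n, measurable (T_ n)) -> measurable T -> (0 < nu T)%E ->
  {ae nu, forall z, \forall n \near \oo, T_ n z <-> T z} ->
  bounded_borel f ->
  avg (T_ n) f @[n --> \oo] --> avg T f.
Proof.
move=> mT_ mT T0 aeT.
have cvgI g : bounded_borel g ->
    \int[nu]_(z in T_ n) g z @[n --> \oo] --> \int[nu]_(z in T) g z.
  move=> bg; have [mg [M gM]] := (bounded_borelP g).1 bg.
  have mgr A : measurable A -> measurable_fun setT (EFin \o (g \_ A)).
    move=> mA; apply/measurable_EFinP/(measurable_restrictT _ mA).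
    exact: measurable_funS mg.
  have [] := @dominated_convergence _ _ _ nu setT measurableT
    (fun n => EFin \o (g \_ (T_ n))) (EFin \o (g \_ T)) (fun=> M%:E).
  - by move=> n; exact: mgr.
  - exact: mgr.
  - apply: filterS aeT => z zT _; apply/fine_cvgP; split; first exact: nearW.
    apply: cvg_near_cst; apply: filterS zT => n /= zT.
    by rewrite !patchE; congr (if _ then _ else _); apply/idP/idP; rewrite !inE => /zT.
  - have := integrable_bounded_borel measurableT (bounded_borel_cst N M).
    by apply.
  - apply: aeW => z n _ /=; rewrite lee_fin patchE; case: ifP => // _.
    by rewrite normr0 (le_trans _ (gM 0)).
  move=> ig _ cg.
  rewrite Rintegral_mkcond; under eq_cvg do rewrite Rintegral_mkcond.
  by apply: fine_cvg; rewrite fineK//; exact: integrable_fin_num ig.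
move=> bf; apply: cvgM; first exact: cvgI.
have fineT : fine (nu T) != 0.
  by rewrite gt_eqF// fine_gt0// T0 fin_nu.
apply: cvgV => //; have := cvgI _ (bounded_borel_cst N 1).
rewrite Rintegral_cst// mul1r; apply: cvg_trans; apply: near_eq_cvg.
by apply: nearW => n; rewrite Rintegral_cst// mul1r.
Qed.

End averages.

(** * Dirichlet problems for operators that contract on [D] *)

Lemma le0_geometric (R : realType) (q r K : R) : 0 <= q < 1 ->
  (forall n, r <= q ^+ n * K) -> r <= 0.
Proof.
move=> /andP[q0 q1] h.
have c : q ^+ n * K @[n --> \oo] --> 0 * K.
  by apply: cvgM; [apply: cvg_expr; rewrite ger0_norm|exact: cvg_cst].
rewrite -(mul0r K) -(cvg_lim _ c)//; apply: limr_ge; last exact: nearW.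
by apply/cvg_ex; exists (0 * K).
Qed.

Lemma measurable_sup_range d (T : measurableType d) (R : realType)
    (h : (T -> R)^nat) :
  (forall n, measurable_fun setT (h n)) ->
  (forall x, has_ubound (range (h ^~ x))) ->
  measurable_fun setT (fun x => sup (range (h ^~ x))).
Proof.
move=> mh hb; rewrite (_ : (fun x => _) = (fun x => sups (h ^~ x) 0)).
  by apply: measurable_fun_sups => // x _; exact: hb.
apply/funext => x; congr sup; apply/seteqP; split => _ [n _ <-]; first by exists n.
by exists n.
Qed.

Section contractive_dirichlet_problem.
Context (R : realType) (N : nat).
Implicit Types (F u v : 'rV[R]_N -> R).
Variables (A : ('rV[R]_N -> R) -> 'rV[R]_N -> R) (D : set 'rV[R]_N) (q : R).
Hypothesis mD : measurable D.
Hypothesis q01 : 0 <= q < 1.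
Hypothesis measurable_A : forall u, bounded_borel u -> measurable_fun setT (A u).
Hypothesis A_bound : forall u M, bounded_borel u -> (forall x, `|u x| <= M) ->
  forall x, `|A u x| <= M.
Hypothesis A_contract : forall u v K, bounded_borel u -> bounded_borel v ->
  0 <= K -> (forall x, u x - v x <= K) -> (forall x, ~ D x -> u x - v x <= 0) ->
  forall x, D x -> A u x - A v x <= q * K.

Let q0 : 0 <= q. Proof. by case/andP: q01. Qed.

(** If [u - v <= K] everywhere then on [D] one has
    [u - v <= A u - A v <= q * K], and off [D] even [u - v <= 0]; this can be
    iterated. *)
Lemma comparison u v : bounded_borel u -> bounded_borel v ->
  (forall x, D x -> u x <= A u x) -> (forall x, D x -> A v x <= v x) ->
  (forall x, ~ D x -> u x <= v x) -> forall x, u x <= v x.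
Proof.
move=> bu bv sub super uvF.
have /bounded_borelP[_ [K uvK]] := bounded_borelB bu bv.
have K0 : 0 <= K by exact: le_trans (normr_ge0 _) (uvK 0).
suff h n : forall x, u x - v x <= q ^+ n * K.
  by move=> x; rewrite -subr_le0; apply: (le0_geometric q01) => n; exact: h.
elim: n => [|n IH] x.
  by rewrite expr0 mul1r; apply: le_trans (uvK x); exact: ler_norm.
have qnK : 0 <= q ^+ n * K by rewrite mulr_ge0// exprn_ge0.
have [Dx|nDx] := pselect (D x); last first.
  by rewrite (@le_trans _ _ 0) ?subr_le0 ?uvF// exprS -mulrA mulr_ge0.
rewrite exprS -mulrA; apply: (le_trans (y := A u x - A v x)).
  by rewrite lerB// ?sub ?super.
by apply: A_contract => // y nDy; rewrite subr_le0 uvF.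
Qed.

(** Picard iteration started at [F].  All iterates agree off [D], which is the
    condition under which [A] contracts. *)
Lemma dirichlet_exists F : bounded_borel F -> exists u,
  [/\ bounded_borel u, forall x, D x -> u x = A u x & forall x, ~ D x -> u x = F x].
Proof.
move=> bF; have [mF [M FM]] := (bounded_borelP F).1 bF.
have M0 : 0 <= M by exact: le_trans (normr_ge0 _) (FM 0).
pose Phi u x := if x \in D then A u x else F x.
pose U n := iter n Phi F.
have UF n x : ~ D x -> U n x = F x.
  by case: n => [//|n nDx]; rewrite /U iterS /Phi memNset.
have UD n x : D x -> U n.+1 x = A (U n) x by move=> Dx; rewrite /U iterS /Phi mem_set.
have bUM n : bounded_borel (U n) /\ forall x, `|U n x| <= M.
  elim: n => [//|n [bU UM]].
  have US x : `|U n.+1 x| <= M.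
    by rewrite /U iterS /Phi; case: ifP => // _; exact: A_bound.
  split => //; apply/bounded_borelP; split; last by exists M.
  rewrite /U iterS; apply: measurable_fun_ifT => //; last exact: measurable_A.
  by apply: (measurable_fun_bool true); rewrite setTI preimage_mem_true.
pose B := M + M.
have B0 : 0 <= B by rewrite addr_ge0.
have qB n : 0 <= q ^+ n * B by rewrite mulr_ge0// exprn_ge0.
have UB n : forall m k x, U (n + m)%N x - U (n + k)%N x <= q ^+ n * B.
  elim: n => [|n IH] m k x.
    rewrite expr0 mul1r (le_trans (ler_norm _))// (le_trans (ler_normB _ _))//.
    by rewrite lerD//; exact: (bUM _).2.
  have [Dx|nDx] := pselect (D x); last by rewrite !UF// subrr qB.
  rewrite !addSn !UD// exprS -mulrA; apply: A_contract => //.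
  - exact: (bUM _).1.
  - exact: (bUM _).1.
  - by move=> y nDy; rewrite !UF// subrr.
have Uij i j x : U i x - q ^+ i * B <= U j x + q ^+ j * B.
  rewrite lerBlDr -addrA -lerBlDl; have [ij|/ltnW ji] := leqP i j.
    by have := UB i 0%N (j - i)%N x; rewrite addn0 subnKC// => /le_trans; apply; rewrite lerDr.
  by have := UB j (i - j)%N 0%N x; rewrite addn0 subnKC// => /le_trans; apply; rewrite lerDl.
(* The band of width [q ^+ i * B] around the i-th iterate contains all later
   ones, so the supremum of its lower ends is the limit of the iterates. *)
pose u x := sup (range (fun i => U i x - q ^+ i * B)).
have ubU x : has_ubound (range (fun i => U i x - q ^+ i * B)).
  by exists (U 0%N x + q ^+ 0 * B) => _ [i _ <-]; exact: Uij.
have uU n x : `|u x - U n x| <= q ^+ n * B.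
  rewrite ler_distl; apply/andP; split.
    by apply: ub_le_sup => //; exists n.
  by apply: ge_sup => [|_ [i _ <-]]; [exists (U 0%N x - q ^+ 0 * B); exists 0%N|exact: Uij].
have uF x : ~ D x -> u x = F x.
  move=> nDx; apply/eqP; rewrite -subr_eq0 -normr_le0.
  by apply: (le0_geometric q01) => n; rewrite -(UF n)// uU.
have bu : bounded_borel u.
  apply/bounded_borelP; split.
    apply: measurable_sup_range => // n; apply: measurable_funB => //.
    by have /bounded_borelP[] := (bUM n).1.
  exists (B + M) => x; rewrite -[u x](subrK (U 0%N x)) (le_trans (ler_normD _ _))//.
  by rewrite lerD ?(bUM _).2//; have := uU 0%N x; rewrite expr0 mul1r.
exists u; split => // x Dx; apply/eqP; rewrite -subr_eq0 -normr_le0.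
apply: (@le0_geometric _ q _ (q * B + q * B)) => // n.
have Au v w : bounded_borel v -> bounded_borel w ->
    (forall y, `|v y - w y| <= q ^+ n * B) -> (forall y, ~ D y -> v y = w y) ->
    A v x - A w x <= q * (q ^+ n * B).
  move=> bv bw vw vwF; apply: A_contract => // y.
    by rewrite (le_trans (ler_norm _)).
  by move=> /vwF->; rewrite subrr.
have UFu y : ~ D y -> U n y = u y by move=> nDy; rewrite UF// uF.
have AuU : `|A (U n) x - A u x| <= q * (q ^+ n * B).
  rewrite ler_norml lerNl opprB !Au//; try exact: (bUM n).1.
  by move=> y; rewrite distrC.
  by move=> y nDy; rewrite UFu.
rewrite -[u x](subrK (U n.+1 x)) -addrA (le_trans (ler_normD _ _))//.
rewrite mulrDr lerD//; first by rewrite mulrA -exprSr.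
by rewrite UD// mulrCA.
Qed.

End contractive_dirichlet_problem.

(** * Suprema of averages over directions *)

Section extremal_averages.
Context (R : realType) (N : nat).
Variables (nu : {finite_measure set 'rV[R]_N -> \bar R}).
Variables (Y : set 'rV[R]_N) (T : 'rV[R]_N -> set 'rV[R]_N).
Hypothesis Y0 : Y !=set0.
Hypothesis mT : forall y, measurable (T y).
Implicit Types (u v : 'rV[R]_N -> R).

(** The infimum is [- upper (- u)], so the supremum alone needs a theory. *)
Definition upper u x : R := sup [set avg nu (T y) (fun z => u (x + z)) | y in Y].

Lemma avg_bound y f M : bounded_borel f -> (forall z, `|f z| <= M) ->
  `|avg nu (T y) f| <= M.
Proof.
move=> bf fM; have M0 : 0 <= M by exact: le_trans (normr_ge0 _) (fM 0).
have le g : bounded_borel g -> (forall z, `|g z| <= M) -> avg nu (T y) g <= M.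
  move=> bg gM; have := @avg_le _ _ nu (T y) set0 g M 0.
  rewrite subr0 mul1r setI0 measure0 mul0e; apply => // z.
  by rewrite (le_trans (ler_norm _)).
rewrite ler_norml le// andbT lerNl -avgN//; apply: le.
  exact: bounded_borelN.
by move=> z; rewrite normrN.
Qed.

Lemma has_sup_upper u x : bounded_borel u ->
  has_sup [set avg nu (T y) (fun z => u (x + z)) | y in Y].
Proof.
move=> bu; have /bounded_borelP[_ [M uM]] := bu; split.
  by have [y Yy] := Y0; exists (avg nu (T y) (fun z => u (x + z))), y.
exists M => _ [y Yy <-]; apply: le_trans (ler_norm _) _.
by apply: avg_bound => //; exact: bounded_borel_shift.
Qed.

Lemma upper_ge u x y : bounded_borel u -> Y y ->
  avg nu (T y) (fun z => u (x + z)) <= upper u x.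
Proof.
move=> bu Yy; apply: ub_le_sup; first exact: (has_sup_upper x bu).2.
by exists y.
Qed.

Lemma upper_le u x M : bounded_borel u ->
  (forall y, Y y -> avg nu (T y) (fun z => u (x + z)) <= M) -> upper u x <= M.
Proof.
move=> bu h; apply: ge_sup; first exact: (has_sup_upper x bu).1.
by move=> _ [y Yy <-]; exact: h.
Qed.

Lemma upper_bound u x M : bounded_borel u -> (forall z, `|u z| <= M) ->
  `|upper u x| <= M.
Proof.
move=> bu uM; have b y : `|avg nu (T y) (fun z => u (x + z))| <= M.
  by apply: avg_bound => //; exact: bounded_borel_shift.
rewrite ler_norml; apply/andP; split.
  have [y Yy] := Y0; apply: le_trans (upper_ge x bu Yy).
  by have := b y; rewrite ler_norml => /andP[].
by apply: upper_le => // y _; exact: le_trans (ler_norm _) (b y).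
Qed.

Lemma upper_contract (far : set 'rV[R]_N) (l K : R) u v x :
  measurable far -> l <= 1 ->
  (forall y, Y y -> nu (T y `&` far) = (l%:E * nu (T y))%E) ->
  bounded_borel u -> bounded_borel v -> 0 <= K ->
  (forall z, u z - v z <= K) -> (forall z, far z -> u (x + z) - v (x + z) <= 0) ->
  upper u x - upper v x <= (1 - l) * K.
Proof.
move=> mfar l1 nul bu bv K0 uvK uv0; rewrite lerBlDr; apply: upper_le => // y Yy.
have := upper_ge x bv Yy; rewrite -(lerD2l ((1 - l) * K)); apply: le_trans.
rewrite -lerBlDr -avgB//; try exact: bounded_borel_shift.
apply: (avg_le (far := far)) => //; last exact: nul.
by apply: bounded_borelB; exact: bounded_borel_shift.
Qed.

(** Approximating a direction [y] by directions [d (k n)] makes the averages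
    converge, so the supremum over [Y] is the supremum along [d]. *)
Lemma measurable_upper (d : nat -> 'rV[R]_N) u :
  (forall n, Y (d n)) ->
  (forall y, Y y -> exists k : nat -> nat,
    {ae nu, forall z, \forall n \near \oo, T (d (k n)) z <-> T y z}) ->
  (forall y, Y y -> (0 < nu (T y))%E) ->
  bounded_borel u -> measurable_fun setT (upper u).
Proof.
move=> Yd dY T0 bu.
pose h n (x : 'rV[R]_N) := avg nu (T (d n)) (fun z => u (x + z)).
have hb x : has_ubound (range (h ^~ x)).
  by exists (upper u x) => _ [n _ <-]; exact: upper_ge.
rewrite (_ : upper u = fun x => sup (range (h ^~ x))).
  by apply: measurable_sup_range => // n; exact: measurable_avg_shift.
apply/funext => x; apply/eqP; rewrite eq_le; apply/andP; split; last first.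
  by apply: ge_sup => [|_ [n _ <-]]; [exists (h 0%N x); exists 0%N|exact: upper_ge].
apply: upper_le => // y Yy; have [k ky] := dY y Yy.
have c := cvg_avg (fun n => mT (d (k n))) (mT y) (T0 y Yy) ky (bounded_borel_shift x bu).
rewrite -(cvg_lim _ c)//; apply: limr_le; first by apply/cvg_ex; eexists; exact: c.
by apply: nearW => n; apply: ub_le_sup => //; exists (k n).
Qed.

End extremal_averages.

(** * The averaging operator on truncated cones *)

Section levy_cones.
Context (R : realType) (N : nat) (s alpha eps : R).
Hypotheses (s0 : 0 < s) (halpha : 0 < alpha <= pi / 2) (eps0 : 0 < eps).
Let s_ge0 : 0 <= s := ltW s0.

Definition open_cone (r : R) (y : 'rV[R]_N) : set 'rV[R]_N :=
  [set z | cos alpha * enorm z < dotp y z /\ r < enorm z].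

Lemma open_open_cone r y : open (open_cone r y).
Proof.
rewrite (_ : open_cone r y = (fun z => dotp y z - cos alpha * enorm z) @^-1` [set x | x > 0]
   `&` @enorm R N @^-1` [set x | x > r]); last first.
  by apply/seteqP; split => z /=; rewrite subr_gt0.
apply: openI; apply: open_comp; try exact: open_gt.
  move=> z _; apply: continuousB; first exact: continuous_dotp.
  by apply: continuousM; [exact: cst_continuous|exact: continuous_enorm].
by move=> z _; exact: continuous_enorm.
Qed.

Lemma measurable_open_cone r y : measurable (open_cone r y).
Proof. by apply: open_measurable_rV; exact: open_open_cone. Qed.

Lemma levy_open_cone_gt0 r y : 0 <= r -> levy_const N s != 0 -> enorm y = 1 ->
  (0 < levy_measure s (open_cone r y))%E.
Proof.
move=> r0 C0 y1; have /andP[c0 c1] := cos_itv halpha.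
apply: levy_measure_open_gt0 => //; first exact: open_open_cone.
  exists ((r + 1) *: y); rewrite /open_cone/= enormZ dotpZr -enorm_sqr y1 expr1n !mulr1.
  have r1 : 0 < r + 1 by rewrite ltr_wpDl.
  by rewrite gtr0_norm// ltrDl gtr_pMl.
by move=> z [_]; exact: le_lt_trans.
Qed.

(** The factor does not depend on [y]: this is what makes the contraction
    constant uniform in the direction. *)
Lemma levy_open_cone_scale (L r : R) y : 0 < L ->
  levy_measure s (open_cone (L * r) y) =
  (((L `^ (2 * s))^-1)%:E * levy_measure s (open_cone r y))%E.
Proof.
move=> L0; rewrite (_ : open_cone r y = (fun z => L *: z) @^-1` open_cone (L * r) y).
  rewrite levy_measure_scale//; last exact: measurable_open_cone.
  by rewrite muleA -EFinM mulVf ?mul1e// gt_eqF// powR_gt0.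
apply/seteqP; split => z; rewrite /open_cone/= enormZ dotpZr gtr0_norm//;
by rewrite mulrCA !ltr_pM2l.
Qed.


(** All cones in the averages lie in [{eps < |z|}], and the restriction of the
    jump measure to this set is finite, as the theory of averages requires. *)
Lemma tail_measure : exists nu : {finite_measure set 'rV[R]_N -> \bar R},
  forall A, nu A = levy_measure s (A `&` [set z | eps < enorm z]).
Proof.
have [m mE] := @levy_measureP R N s s_ge0.
have mfin : (m [set z : 'rV[R]_N | (eps < enorm z)%R] < +oo)%E.
  by rewrite mE; exact: levy_measure_far_fin.
by exists (mfrestr (measurable_enorm_gt eps) mfin) => A; rewrite -mE.
Qed.

Variable nu : {finite_measure set 'rV[R]_N -> \bar R}.
Hypothesis nuE : forall A, nu A = levy_measure s (A `&` [set z | eps < enorm z]).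

Lemma average_cone y f : sphere y ->
  average s (cone alpha eps%:E +oo%E y) f = avg nu (open_cone eps y) f.
Proof.
move=> y1; rewrite (coneE halpha (ltW eps0) y1) -/(open_cone eps y).
have sub A : A `<=` open_cone eps y -> A `&` [set z | eps < enorm z] = A.
  by move=> AT; rewrite setIidl// => z /AT[].
rewrite /average /avg nuE sub//; congr (fine _ / _).
have [m mE] := @levy_measureP R N s s_ge0.
rewrite -mE; apply: eq_measure_integral => A _ AT.
by apply: (etrans _ (esym (nuE A))); rewrite mE sub.
Qed.

Lemma A_opE u x : bounded_borel u -> A_op alpha s eps u x =
  2^-1 * (upper nu (@sphere R N) (open_cone eps) u x
        - upper nu (@sphere R N) (open_cone eps) (fun z => - u z) x).
Proof.
move=> bu; have avgE : [set average s (cone alpha eps%:E +oo%E y) (fun z => u (x + z))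
    | y in @sphere R N] =
    [set avg nu (open_cone eps y) (fun z => u (x + z)) | y in @sphere R N].
  by apply/seteqP; split => _ [y Yy <-]; exists y => //; rewrite average_cone.
rewrite /A_op avgE /upper /inf; congr (_ * (_ - sup _)); apply/seteqP; split.
  move=> _ [_ [y Yy <-] <-]; exists y => //.
  by rewrite avgN//; [exact: measurable_open_cone|exact: bounded_borel_shift].
move=> _ [y Yy <-]; exists (avg nu (open_cone eps y) (fun z => u (x + z))).
  by exists y.
by rewrite avgN//; [exact: measurable_open_cone|exact: bounded_borel_shift].
Qed.

(** Off the boundary of the limit cone, membership is given by a strict
    inequality, which is stable under small changes of the direction. *)
Lemma ae_cvg_open_cone y : sphere y -> exists k : nat -> nat,
  {ae nu, forall z, \forall n \near \oo,
    open_cone eps (rational_direction R N (k n)) z <-> open_cone eps y z}.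
Proof.
move=> y1; have [k ky] := rational_direction_dense y1; exists k.
exists [set z | cos alpha * enorm z = dotp y z]; split.
- exact: measurable_cone_boundary.
- rewrite nuE; apply: levy_measure_null => //.
    by apply: measurableI; [exact: measurable_cone_boundary|exact: measurable_enorm_gt].
  apply/eqP; rewrite -measure_le0.
  rewrite -(lebesgue_rV_cone_boundary (cos_itv halpha) y1).
  apply: le_measure; rewrite ?inE//; last exact: measurable_cone_boundary.
  by apply: measurableI; [exact: measurable_cone_boundary|exact: measurable_enorm_gt].
move=> z; apply: contra_notP => /eqP; rewrite neq_lt => /orP[cz|zc].
  near=> n; have h : cos alpha * enorm z < dotp (rational_direction R N (k n)) z.
    by near: n; exact: cvgr_gt (ky z) _ cz.
  by split=> -[_ ez]; split.
near=> n; have h : dotp (rational_direction R N (k n)) z < cos alpha * enorm z.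
  by near: n; exact: cvgr_lt (ky z) _ zc.
by split=> -[/lt_trans lt _]; [have := lt _ h|have := lt _ zc]; rewrite ltxx.
Unshelve. all: by end_near. Qed.

End levy_cones.

Section A_op_properties.
Context (R : realType) (N : nat) (s alpha eps : R).
Hypotheses (N0 : (0 < N)%N) (s0 : 0 < s) (halpha : 0 < alpha <= pi / 2).
Hypothesis eps0 : 0 < eps.
Implicit Types (u v : 'rV[R]_N -> R).

Let sphere0 : @sphere R N !=set0.
Proof. by exists (std_basis R N 1); exact: std_basis1_sphere. Qed.

Lemma A_op_bound u M : bounded_borel u -> (forall x, `|u x| <= M) ->
  forall x, `|A_op alpha s eps u x| <= M.
Proof.
move=> bu uM x; have [nu nuE] := @tail_measure R N s eps s0 eps0.
have mT y : measurable (@open_cone R N alpha eps y) by exact: measurable_open_cone.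
rewrite (A_opE s0 halpha eps0 nuE)// normrM gtr0_norm// ler_pdivrMl//.
rewrite mulr_natl mulr2n (le_trans (ler_normB _ _))// lerD//.
  exact: upper_bound.
by apply: upper_bound => // [|z]; [exact: bounded_borelN|rewrite normrN].
Qed.

(** If [levy_const N s] is zero, all averages are [0 / 0 = 0]; otherwise all
    cones have positive mass and the supremum may be restricted to countably
    many directions. *)
Lemma measurable_A_op u : bounded_borel u ->
  measurable_fun setT (A_op alpha s eps u).
Proof.
move=> bu; have [nu nuE] := @tail_measure R N s eps s0 eps0.
have mT y : measurable (@open_cone R N alpha eps y) by exact: measurable_open_cone.
have -> : A_op alpha s eps u = (fun x => 2^-1 *
    (upper nu (@sphere R N) (open_cone alpha eps) u x -
     upper nu (@sphere R N) (open_cone alpha eps) (fun z => - u z) x)).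
  by apply/funext => x; exact: (A_opE s0 halpha eps0 nuE).
suff mup v : bounded_borel v ->
    measurable_fun setT (upper nu (@sphere R N) (open_cone alpha eps) v).
  apply: measurable_funM => //; apply: measurable_funB; apply: mup => //.
  exact: bounded_borelN.
move=> bv; have [C0|C0] := eqVneq (levy_const N s) 0.
  rewrite (_ : upper _ _ _ _ = cst 0)//; apply/funext => x.
  rewrite /upper (_ : [set _ | _ in _] = [set 0]) ?sup1//.
  have avg0 y : avg nu (open_cone alpha eps y) (fun z => v (x + z)) = 0.
    by rewrite /avg nuE levy_measure_const0// invr0 mulr0.
  apply/seteqP; split => [_ [y _ <-]|_ ->]; first exact: avg0.
  by have [y Yy] := sphere0; exists y.
apply: (@measurable_upper _ _ _ _ _ sphere0 mT (rational_direction R N)) => //.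
- by move=> n; exact: rational_direction_sphere.
- by move=> y y1; exact: (ae_cvg_open_cone halpha nuE).
- move=> y y1; rewrite nuE setIidl => [|z []//].
  by apply: levy_open_cone_gt0 => //; exact: ltW.
Qed.

(** With [M] a bound of the sup norm on [D], a jump of Euclidean length above
    [2 N M] leaves [D]; [L] is chosen so that [L * eps] is at least [2 N M]. *)
Lemma A_op_contract (D : set 'rV[R]_N) : bounded_set D ->
  exists2 q, 0 <= q < 1 & forall u v K, bounded_borel u -> bounded_borel v ->
  0 <= K -> (forall x, u x - v x <= K) -> (forall x, ~ D x -> u x - v x <= 0) ->
  forall x, D x -> A_op alpha s eps u x - A_op alpha s eps v x <= q * K.
Proof.
move=> [M0 [_ DM0]]; pose M := `|M0| + 1.
have DM x : D x -> `|x| <= M.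
  by move=> Dx; apply: DM0 Dx; rewrite (le_lt_trans (ler_norm _))// ltrDl.
pose L := Num.max 1 (N%:R * (M + M) / eps).
have L1 : 1 <= L by rewrite le_max lexx.
have L0 : 0 < L by rewrite (lt_le_trans ltr01).
have LM : N%:R * (M + M) <= L * eps by rewrite -ler_pdivrMr// le_max lexx orbT.
pose far := [set z : 'rV[R]_N | L * eps < enorm z].
have mfar : measurable far by exact: measurable_enorm_gt.
have exits x z : D x -> far z -> ~ D (x + z).
  move=> Dx; rewrite /far/= => Lz Dxz; move: Lz; apply/negP; rewrite -leNgt.
  apply: (le_trans (enorm_le_mxnorm z)); apply: le_trans LM; rewrite ler_wpM2l//.
  by rewrite -[z](addKr x) addrC (le_trans (ler_normB _ _))// lerD ?DM.
set l := (L `^ (2 * s))^-1.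
have Ls1 : 1 <= L `^ (2 * s).
  by rewrite -[leLHS](powRr0 L) ler_powR// mulr_ge0// ltW.
have l01 : 0 < l <= 1 by rewrite invr_gt0 (lt_le_trans ltr01)//= invf_le1 ?(lt_le_trans ltr01).
have /andP[l0 l1] := l01.
exists (1 - l); first by rewrite subr_ge0 l1 gtrBl.
move=> u v K bu bv K0 uvK uvD x Dx.
have [nu nuE] := @tail_measure R N s eps s0 eps0.
have mT y : measurable (@open_cone R N alpha eps y) by exact: measurable_open_cone.
have nul y : sphere y -> nu (open_cone alpha eps y `&` far) =
    (l%:E * nu (open_cone alpha eps y))%E.
  move=> y1; rewrite !nuE [in RHS]setIidl => [|z []//].
  rewrite -levy_open_cone_scale//; congr levy_measure.
  apply/seteqP; split=> z; first by move=> [[[? ?] ?] ?].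
  move=> [cz Lz]; have ez : eps < enorm z.
    by apply: le_lt_trans Lz; rewrite ler_peMl// ltW.
  by do !split.
have up w1 w2 : bounded_borel w1 -> bounded_borel w2 ->
    (forall z, w1 z - w2 z = u z - v z) ->
    upper nu (@sphere R N) (open_cone alpha eps) w1 x -
    upper nu (@sphere R N) (open_cone alpha eps) w2 x <= (1 - l) * K.
  move=> b1 b2 w12; apply: (@upper_contract _ _ _ _ _ sphere0 mT far) => // z.
    by rewrite w12.
  by move=> farz; rewrite w12; apply: uvD; exact: exits.
rewrite !(A_opE s0 halpha eps0 nuE)//.
have h1 := up u v bu bv (fun=> erefl).
have h2 : upper nu (@sphere R N) (open_cone alpha eps) (fun z => - v z) x -
    upper nu (@sphere R N) (open_cone alpha eps) (fun z => - u z) x <= (1 - l) * K.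
  by apply: up => [||z]; [exact: bounded_borelN..|rewrite opprK addrC].
by lra.
Qed.

End A_op_properties.

Theorem theorem5p1 (R : realType) (N : nat) (hN : (2 <= N)%N)
  (p : R) (hp : 2 <= p) (s : R) (hs : 2^-1 < s < 1)
  (alpha : R) (halpha : is_alpha N p alpha)
  (D : set 'rV[R]_N) (oD : open D) (bD : bounded_set D)
  (eps : R) (heps : 0 < eps) :
  (forall F : 'rV[R]_N -> R, bounded_borel F ->
     (exists! u, is_solution alpha s eps D F u) /\
     (forall u, is_solution alpha s eps D F u -> supnorm u <= supnorm F)) /\
  (forall F Fbar u ubar : 'rV[R]_N -> R,
     bounded_borel F -> bounded_borel Fbar ->
     (forall x, F x <= Fbar x) ->
     is_solution alpha s eps D F u -> is_solution alpha s eps D Fbar ubar ->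
     forall x, u x <= ubar x).
Proof.
have N0 : (0 < N)%N := ltnW hN.
have s0 : 0 < s by case/andP: hs => + _; apply: lt_trans; rewrite invr_gt0.
have [a0 _] := halpha.
have [q q01 Aq] := @A_op_contract _ N _ _ _ N0 s0 a0 heps D bD.
have cmp := comparison q01 Aq.
have mono (F Fbar u ubar : 'rV[R]_N -> R) : (forall x, F x <= Fbar x) ->
    is_solution alpha s eps D F u -> is_solution alpha s eps D Fbar ubar ->
    forall x, u x <= ubar x.
  move=> FF [bu uA uF] [bv vA vF]; apply: cmp => // x Dx.
  - by rewrite -uA.
  - by rewrite -vA.
  - by rewrite uF// vF.
split; last by move=> F Fbar u ubar _ _; exact: mono.
move=> F bF; split.
  have [u uS] := dirichlet_exists (open_measurable_rV oD) q01
    (@measurable_A_op _ N _ _ _ N0 s0 a0 heps)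
    (@A_op_bound _ N _ _ _ N0 s0 a0 heps) Aq bF.
  exists u; split => // v vS; apply/funext => x; apply/eqP.
  by rewrite eq_le (mono F F)//= (mono F F).
move=> u [bu uA uF].
have Fle x : `|F x| <= supnorm F.
  have /bounded_borelP[_ [M FM]] := bF.
  by apply: ub_le_sup; [exists M => _ [y _ <-]|exists x].
have c0 : 0 <= supnorm F by exact: le_trans (normr_ge0 _) (Fle 0).
have Ac (c : R) (x : 'rV[R]_N) : `|c| <= supnorm F -> `|A_op alpha s eps (fun=> c) x| <= supnorm F.
  by move=> cF; apply: A_op_bound => //; exact: bounded_borel_cst.
apply: ge_sup => [|_ [x _ <-]]; first by exists `|u 0|, 0.
rewrite ler_norml; apply/andP; split.
- apply: (cmp (fun=> - supnorm F) u) => //; first exact: bounded_borel_cst.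
  + by move=> y _; have := Ac (- supnorm F) y; rewrite normrN ger0_norm// => /(_ (lexx _));
      rewrite ler_norml => /andP[].
  + by move=> y Dy; rewrite -uA.
  + by move=> y nDy; rewrite uF//; have := Fle y; rewrite ler_norml => /andP[].
- apply: (cmp u (fun=> supnorm F)) => //; first exact: bounded_borel_cst.
  + by move=> y Dy; rewrite -uA.
  + by move=> y _; have := Ac (supnorm F) y; rewrite ger0_norm// => /(_ (lexx _));
      rewrite ler_norml => /andP[].
  + by move=> y nDy; rewrite uF//; have := Fle y; rewrite ler_norml => /andP[].
Qed.
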